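(* Let $(R,\mathfrak m)$ and $(S,\mathfrak n)$ be commutative Noetherian local rings and let $\varphi: R\hookrightarrow S$ be a module-finite extension. The following statements are true. (a) Let $B$ be an $S$-module. Then $B$ is Artinian as an $S$-module if and only if $B$ is Artinian as an $R$-module via $\varphi$. In this case $\dim_S(B)=\dim_R(B)$ and $$\operatorname{Att}_S(B)\subseteq\bigcup_{\mathfrak p\in\operatorname{Att}_R(B)}\operatorname{Assh}_S(S/\mathfrak pS).$$ (b) If $A$ is an Artinian $R$-module, then $A\otimes_RS$ is an Artinian $S$-module. In this case $\dim_S(A\otimes_RS)=\dim_R(A)$ and $$\operatorname{Att}_S(A\otimes_RS)\subseteq\bigcup_{\mathfrak p\in\operatorname{Att}_R(A)}\operatorname{Assh}_S(S/\mathfrak pS).$$ (c) The equality $\operatorname{Att}_S(B)=\bigcup_{\mathfrak p\in\operatorname{Att}_R(B)}\operatorname{Assh}_S(S/\mathfrak pS)$ holds for every Artinian $S$-module $B$ if and only if the induced map $\varphi^*:\operatorname{Spec}(S)\to\operatorname{Spec}(R)$, $\mathfrak P\mapsto\mathfrak P\cap R$, is a bijection.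
   Context: A module-finite extension $\varphi: R\hookrightarrow S$ is an injective ring homomorphism such that $S$ is finitely generated as an $R$-module via $\varphi$. For an ideal $I$ of $R$, $IS$ denotes $\varphi(I)S$; for an ideal $\mathfrak J$ of $S$, $\mathfrak J\cap R$ denotes $\varphi^{-1}(\mathfrak J)$. Every $S$-module is regarded as an $R$-module via $\varphi$. For an Artinian module $A$ over a local ring $R$, $\dim_R(A):=\dim(R/\operatorname{Ann}_RA)$. For a finitely generated $R$-module $M$, $\operatorname{Assh}_R(M):=\{\mathfrak p\in\operatorname{Ass}_R(M)\mid\dim(R/\mathfrak p)=\dim_R(M)\}$. (The same notation is used over $S$.) Attached primes (Macdonald): an $R$-module $A$ is $\mathfrak p$-secondary, for $\mathfrak p\in\operatorname{Spec}(R)$, if $A\neq 0$, multiplication by $r$ on $A$ is surjective for all $r\in R\setminus\mathfrak p$, and multiplication by $r$ on $A$ is nilpotent for all $r\in\mathfrak p$. A minimal secondary representation of $A$ is an expression $A=A_1+\dots+A_n$ with each $A_i$ a $\mathfrak p_i$-secondary submodule, no $A_i$ redundant, and $\mathfrak p_i\neq\mathfrak p_j$ for $i\neq j$. If one exists (as it does for every nonzero Artinian module), the set $\{\mathfrak p_1,\dots,\mathfrak p_n\}$ does not depend on the representation and is denoted $\operatorname{Att}_R(A)$; also $\operatorname{Att}_R(0)=\emptyset$. *)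

(* Defs.v *)
From HB Require Import structures.
From mathcomp Require Import all_boot all_order all_algebra.
From mathcomp Require Import boolp classical_sets functions constructive_ereal.
From mathcomp Require Import freeg.

Set Implicit Arguments.
Unset Strict Implicit.
Unset Printing Implicit Defensive.

Import Order.TTheory GRing.Theory Num.Theory.

Local Open Scope classical_set_scope.
Local Open Scope ring_scope.

Section Submodules.
Variables (R : pzRingType) (V : lmodType R).
Implicit Types (N : set V).

Definition submodule N : Prop := submod_closed (mem N).

Definition span N : set V := smallest submodule N.

Lemma submoduleP N :
  submodule N <-> N 0 /\ forall (a : R) x y, N x -> N y -> N (a *: x + y).
Proof.
rewrite /submodule; split=> [[N0 Nlin]|[N0 Nlin]].
  split=> [|a x y Nx Ny]; first exact: set_mem N0.
  by apply: set_mem; apply: Nlin; apply: mem_set.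
split=> [|a x y Nx Ny]; first exact: mem_set.
by apply: mem_set; apply: Nlin; apply: set_mem.
Qed.

Lemma span_submodule N : submodule (span N).
Proof.
apply/submoduleP; split=> [M [/submoduleP[M0 _] _] //|a x y sx sy M MN].
have [/submoduleP[_ Mlin] _] := MN.
by apply: Mlin; [apply: sx|apply: sy].
Qed.

Lemma span_id N : submodule N -> span N = N.
Proof. exact: smallest_id. Qed.

Definition fin_gen N : Prop := exists s : seq V, N = span [set` s].

Definition artinian : Prop :=
  forall N : nat -> set V,
    (forall i, submodule (N i)) -> (forall i, N i.+1 `<=` N i) ->
    exists n, forall k, (n <= k)%N -> N k = N n.

Definition ann : set R := [set r | forall x : V, r *: x = 0].

Definition sum_submod (n : nat) (P : pred 'I_n) (N : 'I_n -> set V) : set V :=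
  [set x | exists2 f : 'I_n -> V,
    forall i, P i -> N i (f i) & x = \sum_(i | P i) f i].

End Submodules.

Arguments artinian {R} V.
Arguments ann {R} V.

(* The quotient of [V] by the submodule generated by [N]; taking an arbitrary
   set [N] keeps the construction total, and [span_id] applies when [N] is
   already a submodule. *)
Section QuotientModule.
Variables (R : pzRingType) (V : lmodType R) (N : set V).

Definition span_pred : {pred V} := mem (span N).

Fact span_pred_zmod_closed : zmod_closed span_pred.
Proof. exact: GRing.submod_closedB (span_submodule N). Qed.

HB.instance Definition _ :=
  GRing.isZmodClosed.Build V span_pred span_pred_zmod_closed.

Definition quot_mod : Type := Quotient.quot span_pred.

HB.instance Definition _ := GRing.Zmodule.on quot_mod.

Definition quot_pi (x : V) : quot_mod := \pi_(Quotient.quot span_pred)%qT x.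

Definition quot_repr (x : quot_mod) : V := @generic_quotient.repr V
  (Quotient.quot span_pred) x.

Lemma quot_reprK : cancel quot_repr quot_pi.
Proof. exact: reprK. Qed.

Lemma quot_piP x y : quot_pi x = quot_pi y <-> span N (x - y).
Proof.
have E := Quotient.idealrBE span_pred x y.
split=> [/eqP|] xy; last by apply/eqP; rewrite -[_ == _]E; exact: mem_set.
by apply: set_mem; rewrite -[_ \in _]/(_ \in span_pred) E.
Qed.

Lemma quot_pi_reprP x : span N (quot_repr (quot_pi x) - x).
Proof. by apply/quot_piP; rewrite quot_reprK. Qed.

Lemma quot_piB : {morph quot_pi : x y / x - y}.
Proof. by move=> x y; exact: (raddfB (\pi_(Quotient.quot span_pred)%qT)). Qed.

HB.instance Definition _ :=
  GRing.isZmodMorphism.Build V quot_mod quot_pi quot_piB.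

Definition quot_scale (a : R) (x : quot_mod) : quot_mod :=
  quot_pi (a *: quot_repr x).

Lemma quot_scaleE a x : quot_scale a (quot_pi x) = quot_pi (a *: x).
Proof.
apply/quot_piP; rewrite -scalerBr.
have /submoduleP[N0 Nlin] := span_submodule N.
by rewrite -[_ *: _]addr0; apply: Nlin => //; exact: quot_pi_reprP.
Qed.

Fact quot_scaleA a b x : quot_scale a (quot_scale b x) = quot_scale (a * b) x.
Proof. by rewrite -(quot_reprK x) !quot_scaleE scalerA. Qed.

Fact quot_scale1 : left_id 1 quot_scale.
Proof. by move=> x; rewrite -(quot_reprK x) quot_scaleE scale1r. Qed.

Fact quot_scaleDr : right_distributive quot_scale +%R.
Proof.
move=> a x y; rewrite -(quot_reprK x) -(quot_reprK y) -raddfD !quot_scaleE.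
by rewrite scalerDr raddfD.
Qed.

Fact quot_scaleDl x : {morph quot_scale^~ x : a b / a + b}.
Proof.
by move=> a b; rewrite -(quot_reprK x) !quot_scaleE scalerDl raddfD.
Qed.

HB.instance Definition _ := GRing.Zmodule_isLmodule.Build R quot_mod
  quot_scaleA quot_scale1 quot_scaleDr quot_scaleDl.

Fact quot_pi_scalable : scalable quot_pi.
Proof. by move=> a x; rewrite -quot_scaleE. Qed.

HB.instance Definition _ :=
  GRing.isScalable.Build R V quot_mod *:%R quot_pi quot_pi_scalable.

Section Lift.
Variables (W : lmodType R) (f : {linear V -> W}).
Hypothesis fN : forall x, N x -> f x = 0.

Definition quot_lift (x : quot_mod) : W := f (quot_repr x).

Lemma span_ker x : span N x -> f x = 0.
Proof.
apply: (@smallest_sub _ _ N [set x | f x = 0]) => //.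
apply/submoduleP; split=> [|a u v /= fu fv]; first exact: raddf0.
by rewrite linearP fu fv scaler0 addr0.
Qed.

Lemma quot_liftE x : quot_lift (quot_pi x) = f x.
Proof.
apply/eqP; rewrite /quot_lift -subr_eq0 -(raddfB f); apply/eqP.
by apply: span_ker; exact: quot_pi_reprP.
Qed.

Lemma quot_lift_linear : linear quot_lift.
Proof.
move=> a x y; rewrite -(quot_reprK x) -(quot_reprK y) -linearP !quot_liftE.
exact: linearP.
Qed.

End Lift.

End QuotientModule.

Section Ideals.
Variable R : comPzRingType.
Implicit Types (I p m : set R).

Definition ideal I : Prop := submodule (I : set R^o).

Definition prime_ideal p : Prop :=
  [/\ ideal p, ~ p 1 & forall x y, p (x * y) -> p x \/ p y].

Definition Spec : set (set R) := [set p | prime_ideal p].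

Definition maximal_ideal m : Prop :=
  [/\ ideal m, ~ m 1 &
      forall I, ideal I -> m `<=` I -> I = m \/ I = [set: R]].

Definition is_local m : Prop :=
  maximal_ideal m /\ forall m', maximal_ideal m' -> m' = m.

Definition noetherian : Prop :=
  forall I, ideal I -> fin_gen (I : set R^o).

(* The value lies in [\bar int] so that the supremum always exists; it is
   [-oo] exactly when there is no prime ideal, that is for the zero ring. *)
Definition krull_dim : \bar int :=
  supremum -oo%E [set (n%:Z)%:E%E | n in
    [set n : nat | exists2 p : nat -> set R,
       forall i, (i <= n)%N -> prime_ideal (p i) &
       forall i, (i < n)%N -> p i `<` p i.+1]].

Variable I : set R.

Definition quot_ring : Type := quot_mod (I : set R^o).

HB.instance Definition _ := GRing.Lmodule.on quot_ring.

Let pi (x : R) : quot_ring := quot_pi (I : set R^o) x.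

Definition quot_one : quot_ring := pi 1.

Definition quot_mul (x y : quot_ring) : quot_ring :=
  pi ((quot_repr x : R) * (quot_repr y : R)).

Lemma quot_mulE (x y : R) : quot_mul (pi x) (pi y) = pi (x * y).
Proof.
apply/quot_piP.
have /submoduleP[N0 Nlin] := span_submodule (I : set R^o).
set x' : R := quot_repr (pi x); set y' : R := quot_repr (pi y).
have -> : (x' * y' : R^o) - (x * y : R^o)
        = y' *: (x' - x : R^o) + (x *: (y' - y : R^o) + 0).
  rewrite addr0 /GRing.scale /= !mulrBr (mulrC y' x') (mulrC y' x).
  by rewrite addrA subrK.
apply: (Nlin); first exact: quot_pi_reprP.
by apply: (Nlin) => //; exact: quot_pi_reprP.
Qed.

Lemma quot_ringP (P : quot_ring -> Prop) : (forall x : R, P (pi x)) -> forall x, P x.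
Proof. by move=> Ppi x; rewrite -(quot_reprK x); exact: Ppi. Qed.

Fact quot_mulA : associative quot_mul.
Proof.
elim/quot_ringP=> x; elim/quot_ringP=> y; elim/quot_ringP=> z.
by rewrite !quot_mulE mulrA.
Qed.

Fact quot_mulC : commutative quot_mul.
Proof. by elim/quot_ringP=> x; elim/quot_ringP=> y; rewrite !quot_mulE mulrC. Qed.

Fact quot_mul1 : left_id quot_one quot_mul.
Proof. by elim/quot_ringP=> x; rewrite quot_mulE mul1r. Qed.

Fact quot_mulDl : left_distributive quot_mul +%R.
Proof.
elim/quot_ringP=> x; elim/quot_ringP=> y; elim/quot_ringP=> z.
have piD (u v : R) : pi u + pi v = pi (u + v).
  exact: esym (raddfD (quot_pi (I : set R^o)) u v).
by rewrite piD !quot_mulE mulrDl -piD.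
Qed.

HB.instance Definition _ := GRing.Zmodule_isComPzRing.Build quot_ring
  quot_mulA quot_mulC quot_mul1 quot_mulDl.

End Ideals.

Arguments Spec R : clear implicits.
Arguments noetherian R : clear implicits.
Arguments krull_dim R : clear implicits.

Section ModulesOverCommutativeRings.
Variables (R : comPzRingType) (V : lmodType R).
Implicit Types (p : set R) (N : set V).

(* dim (R / Ann V), used both for Artinian and for finitely generated V *)
Definition mdim : \bar int := krull_dim (quot_ring (ann V)).

Definition Ass : set (set R) :=
  [set p | prime_ideal p /\ exists x : V, p = [set r | r *: x = 0]].

Definition Assh : set (set R) :=
  [set p | Ass p /\ krull_dim (quot_ring p) = mdim].

Definition secondary p N : Prop :=
  [/\ prime_ideal p,
      submodule N /\ N <> [set 0],
      forall r, ~ p r -> [set r *: x | x in N] = N &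
      forall r, p r -> exists k : nat, forall x, N x -> r ^+ k *: x = 0].

Definition min_secondary_repr (n : nat) (p : 'I_n -> set R)
    (N : 'I_n -> set V) : Prop :=
  [/\ forall i, secondary (p i) (N i),
      sum_submod xpredT N = [set: V],
      forall j, sum_submod (predC1 j) N <> [set: V] &
      injective p].

(* By uniqueness of the set of primes, "some representation" is "every
   representation" as soon as one exists. *)
Definition Att : set (set R) :=
  [set q | exists n (p : 'I_n -> set R) (N : 'I_n -> set V),
     min_secondary_repr p N /\ exists i, q = p i].

End ModulesOverCommutativeRings.

Arguments mdim {R} V.
Arguments Ass {R} V.
Arguments Assh {R} V.
Arguments Att {R} V.

Definition restr (R S : pzRingType) (phi : {rmorphism R -> S})
  (B : lmodType S) : Type := B.

Section RestrictionOfScalars.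
Variables (R S : pzRingType) (phi : {rmorphism R -> S}) (B : lmodType S).

HB.instance Definition _ := GRing.Zmodule.on (restr phi B).

Definition restr_scale (r : R) (b : restr phi B) : restr phi B := phi r *: (b : B).

Fact restr_scaleA a b x :
  restr_scale a (restr_scale b x) = restr_scale (a * b) x.
Proof. by rewrite /restr_scale scalerA rmorphM. Qed.

Fact restr_scale1 : left_id 1 restr_scale.
Proof. by move=> x; rewrite /restr_scale rmorph1 scale1r. Qed.

Fact restr_scaleDr : right_distributive restr_scale +%R.
Proof. by move=> a x y; exact: scalerDr. Qed.

Fact restr_scaleDl x : {morph restr_scale^~ x : a b / a + b}.
Proof. by move=> a b; rewrite /restr_scale rmorphD; exact: scalerDl. Qed.

HB.instance Definition _ := GRing.Zmodule_isLmodule.Build R (restr phi B)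
  restr_scaleA restr_scale1 restr_scaleDr restr_scaleDl.

End RestrictionOfScalars.

(* The tensor product of two R-modules: the free R-module on A * M modulo the
   relations that make (a, m) linear in each variable. *)
Section TensorProduct.
Variables (R : comNzRingType) (A M : lmodType R).

Definition tensor_rel : set {freeg (A * M) / R} :=
  [set u | (exists (r : R) (a a' : A) (m : M),
              u = << (r *: a + a', m) >> - (r *: << (a, m) >> + << (a', m) >>))
        \/ (exists (r : R) (a : A) (m m' : M),
              u = << (a, r *: m + m') >> - (r *: << (a, m) >> + << (a, m') >>))].

Definition tensor : Type := quot_mod tensor_rel.

HB.instance Definition _ := GRing.Lmodule.on tensor.

Definition tens (a : A) (m : M) : tensor := quot_pi tensor_rel << (a, m) >>.

Lemma tens_linearl m : linear (tens^~ m).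
Proof.
move=> r a a'; rewrite /tens -linearP; apply/quot_piP.
by apply: sub_gen_smallest; left; exists r, a, a', m.
Qed.

Lemma tens_linearr a : linear (tens a).
Proof.
move=> r m m'; rewrite /tens -linearP; apply/quot_piP.
by apply: sub_gen_smallest; right; exists r, a, m, m'.
Qed.

Section Universal.
Variables (W : lmodType R) (f : A -> M -> W).
Hypotheses (f_linearl : forall m, linear (f^~ m)).
Hypotheses (f_linearr : forall a, linear (f a)).

Let g : {freeg (A * M) / R} -> W := fglift (fun am => f am.1 am.2).

Let gB : {morph g : x y / x - y} := lift_is_additive (fun am => f am.1 am.2).

HB.instance Definition _ := GRing.isZmodMorphism.Build _ _ g gB.

Let gU k a m : g << k *g (a, m) >> = k *: f a m.
Proof. by rewrite /g liftU. Qed.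

Let gZ : scalable g.
Proof.
move=> c D; rewrite -[D in RHS]freeg_sumE.
have -> : c *: D = \sum_(x <- dom D) << c * coeff x D *g x >> by [].
rewrite !(raddf_sum g) scaler_sumr; apply: eq_bigr => -[a m] _.
transitivity (c *: (coeff (a, m) D *: f a m)).
  by rewrite scalerA; exact: gU.
by congr (_ *: _); apply: esym; exact: gU.
Qed.

HB.instance Definition _ := GRing.isScalable.Build _ _ _ _ g gZ.

Let g_rel x : tensor_rel x -> g x = 0.
Proof.
case=> [[r [a [a' [m ->]]]]|[r [a [m [m' ->]]]]];
  rewrite raddfB raddfD /= gZ !gU !scale1r.
  by rewrite f_linearl subrr.
by rewrite f_linearr subrr.
Qed.

Definition tensor_lift : tensor -> W := @quot_lift _ _ tensor_rel W g.

Lemma tensor_lift_linear : linear tensor_lift.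
Proof. exact: (quot_lift_linear g_rel). Qed.

Lemma tensor_liftE a m : tensor_lift (tens a m) = f a m.
Proof. rewrite /tensor_lift /tens (quot_liftE g_rel) -[RHS]scale1r; exact: gU. Qed.

End Universal.

Lemma tensor_ind (P : tensor -> Prop) :
  P 0 -> (forall r a m x, P x -> P (r *: tens a m + x)) -> forall x, P x.
Proof.
move=> P0 PD x; rewrite -(quot_reprK x) -[quot_repr x]freeg_sumE.
elim/big_rec: _ => [|[a m] y _ Py]; first by rewrite raddf0.
set c := coeff _ _.
have -> : << c *g (a, m) >> = c *: << (a, m) >> :> {freeg (A * M) / R}.
  by apply/eqP/freeg_eqP => z; rewrite coeffZ !coeffU mul1r.
have -> : quot_pi tensor_rel (c *: << (a, m) >> + y)
        = c *: tens a m + quot_pi tensor_rel y.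
  by rewrite raddfD; congr (_ + _); exact: quot_pi_scalable.
exact: PD.
Qed.

Lemma tensor_eq (W : lmodType R) (f g : tensor -> W) :
  linear f -> linear g -> (forall a m, f (tens a m) = g (tens a m)) -> f =1 g.
Proof.
move=> flin glin fg; have h0 h : linear h -> h (0 : tensor) = 0 :> W.
  move=> hlin; have := hlin (-1) 0 0.
  by rewrite scaler0 addr0 scaleN1r addNr.
elim/tensor_ind=> [|r a m x fgx]; first by rewrite !h0.
by rewrite flin glin fg fgx.
Qed.

End TensorProduct.

(* [A (x)_R S] with its S-module structure [s *: (a (x) t) = a (x) (s * t)]. *)
Section BaseChange.
Variables (R S : comNzRingType) (phi : {rmorphism R -> S}) (A : lmodType R).

Let M : lmodType R := restr phi S^o.

Definition base_change : Type := tensor A M.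

HB.instance Definition _ := GRing.Zmodule.on base_change.

Let mulM (s : S) (a : A) (t : M) : tensor A M := tens a ((s * (t : S)) : M).

Let mulM_linearl s t : linear ((mulM s)^~ t).
Proof. by move=> r a a'; exact: tens_linearl. Qed.

Let mulM_linearr s a : linear (mulM s a).
Proof.
move=> r t t'; rewrite /mulM -tens_linearr; congr tens.
by rewrite mulrDr; congr (_ + _); exact: mulrCA.
Qed.

Definition base_change_scale (s : S) : base_change -> base_change :=
  tensor_lift (mulM s).

Lemma base_change_scaleE s a (t : S) :
  base_change_scale s (tens a (t : M)) = tens a ((s * t) : M).
Proof. exact: (tensor_liftE (mulM_linearl s) (mulM_linearr s)). Qed.

Let scale_linear s :
  linear (base_change_scale s : tensor A M -> tensor A M).
Proof.
exact: (tensor_lift_linear (mulM_linearl s) (mulM_linearr s)).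
Qed.

Fact base_change_scaleA s t x :
  base_change_scale s (base_change_scale t x) = base_change_scale (s * t) x.
Proof.
apply: (@tensor_eq _ _ _ _
  (fun y => base_change_scale s (base_change_scale t y))) => [r y z||a u].
- by rewrite !scale_linear.
- exact: scale_linear.
- by rewrite !base_change_scaleE mulrA.
Qed.

Fact base_change_scale1 : left_id 1 base_change_scale.
Proof.
apply: (@tensor_eq _ _ _ _ _ id) => [|r y z //|a u]; first exact: scale_linear.
by rewrite base_change_scaleE mul1r.
Qed.

Fact base_change_scaleDr : right_distributive base_change_scale +%R.
Proof.
move=> s x y; have := scale_linear s 1 x y.
by rewrite !scale1r.
Qed.

Fact base_change_scaleDl x :
  {morph base_change_scale^~ x : s t / s + t}.
Proof.
move=> s t; apply: (@tensor_eq _ _ _ _ (base_change_scale (s + t))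
  (fun y : tensor A M => base_change_scale s y + base_change_scale t y))
  => [|r y z|a u].
- exact: scale_linear.
- by rewrite !scale_linear scalerDr addrACA.
- rewrite !base_change_scaleE mulrDl.
  have := tens_linearr a 1 ((s * u) : M) ((t * u) : M).
  by rewrite !scale1r.
Qed.

HB.instance Definition _ := GRing.Zmodule_isLmodule.Build S base_change
  base_change_scaleA base_change_scale1
  base_change_scaleDr base_change_scaleDl.

End BaseChange.

Section Extensions.
Variables (R S : comNzRingType) (phi : {rmorphism R -> S}).

Definition module_finite_extension : Prop :=
  injective phi /\ fin_gen ([set: restr phi S^o]).

Definition ideal_ext (I : set R) : set S := span (phi @` I : set S^o).

Definition contraction (J : set S) : set R := phi @^-1` J.

End Extensions.

(* Main.v *)
(* Attached primes of an Artinian module are the primes of its secondary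
   quotients. If [K] makes [B / K] a P-secondary quotient over S, the same [K]
   makes it secondary over R for P cap R, and P is a minimal prime of
   (P cap R)S by incomparability; hence (a), once dimensions are compared by
   going up. For (b), A (x) S is covered by the tensors a (x) s with a in the
   secondary components of A, and a rank-one torsion-free quotient of S over
   R/p shows that the annihilator of A (x) S lies in every attached prime p of A.

   For (c), every prime P of S carries an Artinian module with P as its only
   attached prime: K/N, with K the fraction field of S/P and N a submodule
   maximal among those avoiding 1. Two primes P, P' over the same p would both
   have to be attached to it. Conversely, if P in Assh(S/pS) lay over a prime
   larger than p, then dim S/P = dim S/pS would contradict the finiteness of the
   dimension of R, which is Krull's principal ideal theorem. *)
Require Import Defs.
From HB Require Import structures.
From mathcomp Require Import all_boot all_order all_algebra.
From mathcomp Require Import boolp classical_sets functions.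
From mathcomp Require Import constructive_ereal ring.

Local Open Scope classical_set_scope.
Local Open Scope ring_scope.

Set Implicit Arguments.
Unset Strict Implicit.
Unset Printing Implicit Defensive.
Import GRing.Theory.

(** * Submodules and ideals *)

(** Secondary quotients descend for free: an [S]-submodule is an [R]-submodule, and no
    representation has to be rebuilt over the other ring. Conversely, the prime of a secondary
    quotient is detected on any generating family of subsets on each of which every scalar is
    divisible or nilpotent; these subsets need not be submodules, so pure tensors qualify.

    In (b) the obstacle is that [S] need not be flat, so [A] may fail to embed in its base change;
    the annihilator is bounded by a map out of the tensor product, onto a secondary quotient of [A]
    up to a scalar outside the prime.

    Dimensions in (a) and (b) are compared as sets of lengths of chains of primes, so no finiteness
    enters; it is needed only in (c), where two dimensions must be shown to differ. Apart from the
    fraction field of a residue domain nothing is localised: a statement local at a prime carries a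
    multiplier outside it. *)

Section SubmoduleTheory.
Variables (R : pzRingType) (V : lmodType R).
Implicit Types (N M K D : set V).

Lemma submodule0 N : submodule N -> N 0.
Proof. by case/submoduleP. Qed.

Lemma submoduleZ N a x : submodule N -> N x -> N (a *: x).
Proof.
by case/submoduleP=> N0 Nl Nx; rewrite -[_ *: _]addr0; exact: Nl.
Qed.

Lemma submoduleD N x y : submodule N -> N x -> N y -> N (x + y).
Proof.
by case/submoduleP=> N0 Nl Nx Ny; rewrite -[x]scale1r; exact: Nl.
Qed.

Lemma submoduleN N x : submodule N -> N x -> N (- x).
Proof. by move=> sN Nx; rewrite -scaleN1r; exact: submoduleZ. Qed.

Lemma submoduleB N x y : submodule N -> N x -> N y -> N (x - y).
Proof. by move=> sN Nx Ny; apply: submoduleD => //; exact: submoduleN. Qed.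

Lemma submodule_sum N (I : Type) (r : seq I) (P : pred I) (F : I -> V) :
  submodule N -> (forall i, P i -> N (F i)) -> N (\sum_(i <- r | P i) F i).
Proof.
move=> sN NF; elim/big_ind: _ => //; first exact: submodule0.
by move=> x y; exact: submoduleD.
Qed.

Lemma submodule_intro N : N 0 -> (forall x y, N x -> N y -> N (x + y)) ->
  (forall a x, N x -> N (a *: x)) -> submodule N.
Proof.
by move=> N0 ND NZ; apply/submoduleP; split=> // a x y Nx Ny; apply/ND/Ny/NZ.
Qed.

Lemma submodule_set0 : submodule [set 0 : V].
Proof.
by apply: submodule_intro => [|x y -> ->|a x ->]; rewrite /= ?addr0 ?scaler0.
Qed.

Lemma submodule_setT : submodule [set: V].
Proof. by apply: submodule_intro. Qed.

Lemma submoduleI N M : submodule N -> submodule M -> submodule (N `&` M).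
Proof.
move=> sN sM; apply: submodule_intro => [|x y [? ?] [? ?]|a x [? ?]].
- by split; exact: submodule0.
- by split; exact: submoduleD.
- by split; exact: submoduleZ.
Qed.

Lemma sub_span N : N `<=` Defs.span N.
Proof. exact: sub_gen_smallest. Qed.

Lemma span_min N M : submodule M -> N `<=` M -> Defs.span N `<=` M.
Proof. exact: smallest_sub. Qed.

Definition submod_add N M : set V :=
  [set z | exists x y, [/\ N x, M y & z = x + y]].

Lemma submodule_add N M :
  submodule N -> submodule M -> submodule (submod_add N M).
Proof.
move=> sN sM; apply: submodule_intro.
- by exists 0, 0; split; rewrite ?addr0 //; exact: submodule0.
- move=> _ _ [x [y [Nx My ->]]] [x' [y' [Nx' My' ->]]].
  exists (x + x'), (y + y'); split; rewrite 1?addrACA //; exact: submoduleD.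
- move=> a _ [x [y [Nx My ->]]]; exists (a *: x), (a *: y).
  by split; rewrite ?scalerDr //; exact: submoduleZ.
Qed.

Lemma submod_addl N M : submodule M -> N `<=` submod_add N M.
Proof.
by move=> sM x Nx; exists x, 0; split; rewrite ?addr0 //; exact: submodule0.
Qed.

Lemma submod_addr N M : submodule N -> M `<=` submod_add N M.
Proof.
by move=> sN x Nx; exists 0, x; split; rewrite ?add0r //; exact: submodule0.
Qed.

Lemma submod_add_min N M K : submodule K -> N `<=` K -> M `<=` K ->
  submod_add N M `<=` K.
Proof.
move=> sK NK MK _ [x [y [Nx My ->]]].
by apply: submoduleD => //; [exact: NK|exact: MK].
Qed.

Definition line (x : V) : set V := [set a *: x | a in [set: R]].

Lemma submodule_line x : submodule (line x).
Proof.
apply: submodule_intro => [|_ _ [a _ <-] [b _ <-]|c _ [a _ <-]].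
- by exists 0; rewrite ?scale0r.
- by exists (a + b); rewrite ?scalerDl.
- by exists (c * a); rewrite ?scalerA.
Qed.

Lemma line_mem x : line x x.
Proof. by exists 1; rewrite ?scale1r. Qed.

Lemma line_min N x : submodule N -> N x -> line x `<=` N.
Proof. by move=> sN Nx _ [a _ <-]; exact: submoduleZ. Qed.

Lemma submodule_bigcup (F : set (set V)) :
  F !=set0 -> (forall N, F N -> submodule N) -> total_on F subset ->
  submodule (\bigcup_(N in F) N).
Proof.
move=> [N0 FN0] Fsub tot; apply: submodule_intro.
- by exists N0 => //; apply: submodule0; exact: Fsub.
- move=> x y [N FN Nx] [M FM My]; have [NM|MN] := tot _ _ FN FM.
    by exists M => //; apply: submoduleD => //; [exact: Fsub|exact: NM].
  by exists N => //; apply: submoduleD => //; [exact: Fsub|exact: MN].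
- by move=> a x [N FN Nx]; exists N => //; apply: submoduleZ => //; exact: Fsub.
Qed.

(** Zorn's lemma with an arbitrary obstacle [D]: a multiplicative set when a prime is wanted, [1]
    for a maximal ideal, a single vector when that vector should become essential in the
    quotient. *)
Lemma max_avoiding N D : submodule N -> (forall x, N x -> ~ D x) ->
  exists M, [/\ submodule M, N `<=` M, forall x, M x -> ~ D x &
    forall K, submodule K -> M `<=` K -> (forall x, K x -> ~ D x) -> K `<=` M].
Proof.
move=> sN ND.
(* [Zorn_bigcup] also asks for the union of the empty chain, which is not a submodule; [set0] is
   therefore adjoined and discarded at the end. *)
pose P := [set X : set V | X = set0 \/
  [/\ submodule X, N `<=` X & forall x, X x -> ~ D x]].
have [F FP tot|M [PM Mmax]] := @Zorn_bigcup _ P.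
  pose F' := [set X | F X /\ X <> set0].
  have E : \bigcup_(X in F) X = \bigcup_(X in F') X.
    apply/seteqP; split=> x [X FX Xx].
      by exists X => //; split=> // X0; rewrite X0 in Xx.
    by exists X => //; case: FX.
  have F'P X : F' X -> [/\ submodule X, N `<=` X & forall x, X x -> ~ D x].
    by case=> /FP[].
  have [F0|/set0P[X F'X]] := eqVneq F' set0.
    by left; rewrite E F0 bigcup_set0.
  right; rewrite E; split.
  - apply: submodule_bigcup; [by exists X|by move=> Y /F'P[]|].
    by move=> Y Z [FY _] [FZ _]; exact: tot.
  - by move=> x Nx; exists X => //; have [_ NX _] := F'P _ F'X; exact: NX.
  - by move=> x [Y /F'P[_ _ YD]] /YD.
have [M0|[sM NM MD]] := PM.
  exfalso; apply: (Mmax N); last by right; split.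
  rewrite M0; split=> // N0; exact: (N0 0 (submodule0 sN)).
exists M; split=> // K sK MK KD; apply: contrapT => nKM.
apply: (Mmax K); first by split.
by right; split=> //; exact: subset_trans MK.
Qed.

(** For [p = setT] this is the span of [s]; for an ideal [p] it is the product of [p] with that
    span. The recursion lets generators be removed one at a time. *)
Fixpoint lincomb (p : set R) (s : seq V) : set V :=
  if s is x :: s' then
    [set z | exists a y, [/\ p a, lincomb p s' y & z = a *: x + y]]
  else [set 0].

Lemma lincombT_span s : lincomb setT s = Defs.span [set` s].
Proof.
apply/seteqP; split.
  elim: s => [|x s IHs] z /=.
    by move=> ->; exact: (submodule0 (span_submodule _)).
  move=> [a [y [_ sy ->]]]; apply: (submoduleD (span_submodule _)).
    apply: (submoduleZ _ (span_submodule _)).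
    by apply: sub_span; rewrite /= mem_head.
  apply: (@span_min [set` s]); [exact: span_submodule| |exact: IHs].
  by move=> t /= ts; apply: sub_span; rewrite /= inE ts orbT.
have sub t : submodule (lincomb setT t).
  elim: t => [|x t IHt]; first exact: submodule_set0.
  apply: submodule_intro.
  - exists 0, 0; split=> //; first exact: submodule0.
    by rewrite scale0r addr0.
  - move=> _ _ [a [y [_ ty ->]]] [b [z [_ tz ->]]].
    exists (a + b), (y + z); split=> //; first exact: submoduleD.
    by rewrite scalerDl addrACA.
  - move=> c _ [a [y [_ ty ->]]]; exists (c * a), (c *: y); split=> //.
      exact: submoduleZ.
    by rewrite scalerDr scalerA.
apply: span_min => //; elim: s => [//|x s IHs] z /=.
rewrite inE => /orP[/eqP->|zs].
  exists 1, 0; split=> //; first exact: submodule0.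
  by rewrite scale1r addr0.
by exists 0, z; rewrite scale0r add0r; split=> //; exact: IHs.
Qed.

End SubmoduleTheory.

(** * Prime ideals, local rings and maximal elements *)

Section IdealTheory.
Variable R : comNzRingType.
Implicit Types (I J p m W : set R).

Lemma ideal0 I : ideal I -> I 0.
Proof. exact: submodule0. Qed.

Lemma idealD I x y : ideal I -> I x -> I y -> I (x + y).
Proof. exact: submoduleD. Qed.

Lemma idealB I x y : ideal I -> I x -> I y -> I (x - y).
Proof. exact: submoduleB. Qed.

Lemma idealM I a x : ideal I -> I x -> I (a * x).
Proof. exact: submoduleZ. Qed.

Lemma ideal_mulr I a x : ideal I -> I x -> I (x * a).
Proof. by rewrite mulrC; exact: idealM. Qed.

Lemma ideal_intro I : I 0 -> (forall x y, I x -> I y -> I (x + y)) ->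
  (forall a x, I x -> I (a * x)) -> ideal I.
Proof. exact: (@submodule_intro R R^o). Qed.

Lemma ideal_eqT I : ideal I -> I 1 -> I = setT.
Proof.
by move=> idI I1; apply/seteqP; split=> // x _; rewrite -[x]mulr1; exact: idealM.
Qed.

Lemma prime_ideal_ideal p : prime_ideal p -> ideal p. Proof. by case. Qed.

Lemma prime1 p : prime_ideal p -> ~ p 1. Proof. by case. Qed.

Lemma primeM p x y : prime_ideal p -> ~ p x -> ~ p y -> ~ p (x * y).
Proof. by case=> _ _ h nx ny /h[]. Qed.

Lemma primeX p x k : prime_ideal p -> p (x ^+ k) -> p x.
Proof.
move=> pp; elim: k => [/(prime1 pp)//|k IHk]; rewrite exprS.
by have [_ _ h] := pp => /h[|/IHk].
Qed.

Lemma prime_prod p (I : Type) (r : seq I) (P : pred I) (F : I -> R) :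
  prime_ideal p -> (forall i, P i -> ~ p (F i)) ->
  ~ p (\prod_(i <- r | P i) F i).
Proof.
move=> pp nF; elim/big_ind: _ => //; first exact: prime1.
by move=> x y; exact: primeM.
Qed.

(** A maximal ideal avoiding [W] is prime: if [x] and [y] lie outside, adjoining either one meets
    [W], and the product of the two elements met is congruent to a multiple of [x * y]. *)
Lemma prime_avoiding I W : ideal I -> (forall x, I x -> ~ W x) -> W 1 ->
  (forall x y, W x -> W y -> W (x * y)) ->
  exists p, [/\ prime_ideal p, I `<=` p & forall x, p x -> ~ W x].
Proof.
move=> idI IW W1 WM.
have [p [idp Ip pW pmax]] := @max_avoiding R R^o I W idI IW.
exists p; split=> //.
have step x : ~ p x -> exists a b, [/\ W (a + b * x) & p a].
  move=> npx; apply: contrapT => h; apply: npx.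
  apply: (pmax (submod_add p (line (x : R^o)))).
  - by apply: submodule_add => //; exact: submodule_line.
  - by apply: submod_addl; exact: submodule_line.
  - move=> _ [a [_ [pa [b _ <-] ->]]] Wab; apply: h; exists a, b; split=> //.
  - by apply: submod_addr => //; exact: line_mem.
split=> //; first by move=> p1; exact: (pW 1).
move=> x y pxy; apply: contrapT => /not_orP[/step[a [b [Wx pa]]]].
move=> /step[c [d [Wy pc]]]; apply: (pW _ _ (WM _ _ Wx Wy)).
have -> : (a + b * x) * (c + d * y) =
    (c + d * y) * a + (b * x * c + (b * d) * (x * y)).
  by ring.
apply: idealD => //; first exact: idealM.
by apply: idealD => //; exact: idealM.
Qed.

Lemma maximal_prime m : maximal_ideal m -> prime_ideal m.
Proof.
move=> [idm m1 mmax].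
have [|||p [pp mp _]] := @prime_avoiding m [set 1] idm.
- by move=> x mx /= x1; rewrite x1 in mx.
- by [].
- by move=> x y -> ->; rewrite /= mulr1.
have [pm|pT] := mmax p (prime_ideal_ideal pp) mp; first by rewrite -pm.
by case: (prime1 pp); rewrite pT.
Qed.

Lemma local_max m I : is_local m -> ideal I -> ~ I 1 -> I `<=` m.
Proof.
move=> [mm muniq] idI I1.
have [|p [idp Ip p1 pmax]] := @max_avoiding R R^o I [set 1] idI.
  by move=> x Ix /= x1; apply: I1; rewrite -x1.
rewrite -(muniq p) //; split=> //; first by move=> /p1; exact.
move=> J idJ pJ; have [J1|nJ1] := pselect (J 1); first by right; exact: ideal_eqT.
left; apply/seteqP; split=> //; apply: pmax => // x Jx /= x1.
by apply: nJ1; rewrite -x1.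
Qed.

Lemma local_unit m x : is_local m -> ~ m x -> exists y, y * x = 1.
Proof.
move=> lm nmx; apply: contrapT => h; apply: nmx.
apply: (@local_max m (line (x : R^o)) lm); first exact: submodule_line.
  by move=> [y _ yx]; apply: h; exists y.
exact: (@line_mem R R^o).
Qed.

Lemma local_prime m : is_local m -> prime_ideal m.
Proof. by case=> /maximal_prime. Qed.

Definition colon I x : set R := [set r | I (r * x)].

Lemma ideal_colon I x : ideal I -> ideal (colon I x).
Proof.
move=> idI; apply: ideal_intro => [|a b ? ?|a b ?]; rewrite /colon /=.
- by rewrite mul0r; exact: ideal0.
- by rewrite mulrDl; exact: idealD.
- by rewrite -mulrA; exact: idealM.
Qed.

(** The union of a nonempty chain is finitely generated and its generators already lie in one
    member, so the union is that member and Zorn's lemma applies. *)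
Lemma noetherian_max (F : set (set R)) : noetherian R -> F !=set0 ->
  (forall I, F I -> ideal I) ->
  exists2 M, F M & forall I, F I -> M `<=` I -> I `<=` M.
Proof.
move=> noeth [I0 FI0] Fid.
pose P := [set X : set R | X = set0 \/ F X].
have [G GP tot|M [PM Mmax]] := @Zorn_bigcup _ P.
  pose G' := [set X | G X /\ X <> set0].
  have E : \bigcup_(X in G) X = \bigcup_(X in G') X.
    apply/seteqP; split=> x [X GX Xx].
      by exists X => //; split=> // X0; rewrite X0 in Xx.
    by exists X => //; case: GX.
  have G'F X : G' X -> F X by case=> /GP[].
  have [G0|/set0P[X G'X]] := eqVneq G' set0.
    by left; rewrite E G0 bigcup_set0.
  right; rewrite E; set U := \bigcup_(X in G') X.
  have G'tot : total_on G' subset by move=> Y Z [GY _] [GZ _]; exact: tot.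
  have idU : ideal U.
    by apply: (@submodule_bigcup R R^o) => //; [exists X|move=> Y /G'F/Fid].
  have [s sU] := noeth U idU.
  have [Y G'Y sY] : exists2 Y, G' Y & [set` s] `<=` Y.
    have : [set` s] `<=` U by rewrite sU; exact: sub_span.
    elim: {sU} s => [_|x s IHs xsU]; first by exists X.
    have [|Y G'Y sY] := IHs.
      by move=> y ys; apply: xsU; rewrite /= inE ys orbT.
    have [|Z G'Z Zx] := xsU x; first by rewrite /= mem_head.
    have [YZ|ZY] := G'tot _ _ G'Y G'Z.
      by exists Z => // y; rewrite /= inE => /orP[/eqP->//|/sY/YZ].
    by exists Y => // y; rewrite /= inE => /orP[/eqP->|/sY//]; exact: ZY.
  suff -> : U = Y by exact: G'F.
  apply/seteqP; split; last by move=> y Yy; exists Y.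
  by rewrite sU; exact: (@span_min R R^o _ _ (Fid _ (G'F _ G'Y)) sY).
have [M0|FM] := PM.
  exfalso; apply: (Mmax I0); last by right.
  rewrite M0; split=> // I00; exact: (I00 0 (ideal0 (Fid _ FI0))).
exists M => // I FI MI; apply: contrapT => nIM.
by apply: (Mmax I); [split|right].
Qed.

End IdealTheory.

(** * Descending chains *)

Lemma descending_sub (T : Type) (N : nat -> set T) i j :
  (forall i, N i.+1 `<=` N i) -> (i <= j)%N -> N j `<=` N i.
Proof.
move=> Nd /subnK <-; elim: (j - i)%N => [//|k IHk].
by rewrite addSn; exact: subset_trans (Nd _) IHk.
Qed.

Section ChainCondition.
Variables (R : pzRingType) (V : lmodType R).
Implicit Types (M N : set V).

(** Relative to a subset of [V], so that submodules need not become module types of their own. *)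
Definition dcc M : Prop :=
  forall N : nat -> set V, (forall i, submodule (N i)) ->
    (forall i, N i.+1 `<=` N i) -> (forall i, N i `<=` M) ->
    exists n, forall k, (n <= k)%N -> N k = N n.

Lemma artinian_dcc : artinian V <-> dcc setT.
Proof. by split=> [art N sN Nd _|d N sN Nd]; [exact: art|exact: d]. Qed.

Lemma dcc_sub M M' : M `<=` M' -> dcc M' -> dcc M.
Proof. by move=> MM' d N sN Nd NM; apply: d => // i; exact: subset_trans MM'. Qed.

Lemma dcc_set0 : dcc [set 0].
Proof.
move=> N sN Nd N0; exists 0%N => k _; apply/seteqP; split=> x /N0 ->;
  exact: submodule0.
Qed.

Lemma dcc_min (F : set (set V)) : artinian V -> F !=set0 ->
  (forall N, F N -> submodule N) ->
  exists2 M, F M & forall N, F N -> N `<=` M -> N = M.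
Proof.
move=> art [N0 FN0] Fsub; apply: contrapT => nmin.
have next (N : {N | F N}) : {N' : {N | F N} | sval N' `<` sval N}.
  apply: cid; case: N => N FN; apply: contrapT => h; apply: nmin.
  exists N => // N' FN' N'N; apply/seteqP; split=> //; apply: contrapT => h'.
  by apply: h; exists (exist _ N' FN').
have [f [_ fS]] := dependent_choice next (exist _ N0 FN0).
have [||n fn] := art (fun i => sval (f i)).
- by move=> i; apply: Fsub; exact: svalP.
- by move=> i; case: (fS i).
by have [_] := fS n; rewrite -(fn n.+1) //; apply.
Qed.

End ChainCondition.

Section ChainConditionMaps.
Variables (R : pzRingType) (V W : lmodType R).

Lemma submodule_preimage (f : {linear V -> W}) (N : set W) :
  submodule N -> submodule (f @^-1` N).
Proof.
move=> sN; apply: submodule_intro => [|x y|a x]; rewrite /preimage /=.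
- by rewrite raddf0; exact: submodule0.
- by rewrite raddfD; exact: submoduleD.
- by rewrite linearZ; exact: submoduleZ.
Qed.

Lemma submodule_image (f : {linear V -> W}) (N : set V) :
  submodule N -> submodule (f @` N).
Proof.
move=> sN; apply: submodule_intro => [|_ _ [x Nx <-] [y Ny <-]|a _ [x Nx <-]].
- by exists 0; [exact: submodule0|rewrite raddf0].
- by exists (x + y); [exact: submoduleD|rewrite raddfD].
- by exists (a *: x); [exact: submoduleZ|rewrite linearZ].
Qed.

Lemma dcc_image (f : {linear V -> W}) (M : set V) :
  submodule M -> dcc M -> dcc (f @` M).
Proof.
move=> sM dM N sN Nd NM.
have imE i : f @` (f @^-1` N i `&` M) = N i.
  apply/seteqP; split=> [_ [x [fx Mx] <-] //|y Ny].
  by have [x Mx fx] := NM _ _ Ny; exists x => //; split; rewrite /preimage /= ?fx.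
have [|||n stab] := dM (fun i => f @^-1` N i `&` M).
- by move=> i; apply: submoduleI => //; exact: submodule_preimage.
- by move=> i x [fx Mx]; split=> //; exact: Nd fx.
- by move=> i x [].
by exists n => k nk; rewrite -(imE k) -(imE n) stab.
Qed.

(** Nested submodules with the same image under [f] and the same intersection with its kernel
    coincide. *)
Lemma dcc_ext (f : {linear V -> W}) (M : set V) : submodule M ->
  dcc (M `&` f @^-1` [set 0]) -> dcc (f @` M) -> dcc M.
Proof.
move=> sM dK dI N sN Nd NM.
have sK : submodule (f @^-1` [set 0]).
  by apply: submodule_preimage; exact: submodule_set0.
have [|||n1 st1] := dK (fun i => N i `&` f @^-1` [set 0]).
- by move=> i; exact: submoduleI.
- by move=> i x [Nx fx]; split=> //; exact: Nd.
- by move=> i x [Nx fx]; split=> //; exact: NM Nx.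
have [|||n2 st2] := dI (fun i => f @` N i).
- by move=> i; exact: submodule_image.
- by move=> i _ [x Nx <-]; exists x => //; exact: Nd.
- by move=> i _ [x Nx <-]; exists x => //; exact: NM Nx.
exists (maxn n1 n2) => k nk; apply/seteqP; split; first exact: descending_sub.
have [n1k n2k] : (n1 <= k)%N /\ (n2 <= k)%N by apply/andP; rewrite -geq_max.
move=> x Nx.
have: (f @` N k) (f x).
  by rewrite st2 // -(st2 _ (leq_maxr n1 n2)); exists x.
move=> [y Ny fyx].
have : (N k `&` f @^-1` [set 0]) (x - y).
  rewrite st1 // -(st1 _ (leq_maxl n1 n2)); split.
    by apply: submoduleB => //; exact: descending_sub Ny.
  by have: f (x - y) = 0 by rewrite linearB fyx subrr.
by move=> [Nxy _]; rewrite -(subrK y x); exact: submoduleD.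
Qed.

End ChainConditionMaps.

Section ChainConditionAdd.
Variables (R : pzRingType) (V : lmodType R).
Implicit Types (M N : set V).

(** Among nested submodules of [M1 + M2], the trace on [M1] and the trace of [N i + M1] on [M2]
    determine [N i]. *)
Lemma dcc_add M1 M2 : submodule M1 -> submodule M2 ->
  dcc M1 -> dcc M2 -> dcc (submod_add M1 M2).
Proof.
move=> s1 s2 d1 d2 N sN Nd NM.
have [|||n1 st1] := d1 (fun i => N i `&` M1).
- by move=> i; exact: submoduleI.
- by move=> i x [Nx ?]; split=> //; exact: Nd.
- by move=> i x [].
have [|||n2 st2] := d2 (fun i => submod_add (N i) M1 `&` M2).
- by move=> i; apply: submoduleI => //; exact: submodule_add.
- move=> i x [[y [z [Ny Mz ->]]] ?]; split=> //.
  by exists y, z; split=> //; exact: Nd.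
- by move=> i x [].
exists (maxn n1 n2) => k nk; apply/seteqP; split; first exact: descending_sub.
have [n1k n2k] : (n1 <= k)%N /\ (n2 <= k)%N by apply/andP; rewrite -geq_max.
move=> x Nx; have [a [b [Ma Mb xab]]] := NM _ _ Nx.
have : (submod_add (N k) M1 `&` M2) b.
  rewrite st2 // -(st2 _ (leq_maxr n1 n2)); split=> //.
  exists x, (- a); split=> //; first exact: submoduleN.
  by rewrite xab addrAC subrr add0r.
move=> [[x' [a' [Nx' Ma' ba]]] _].
have : (N k `&` M1) (x - x').
  rewrite st1 // -(st1 _ (leq_maxl n1 n2)); split.
    by apply: submoduleB => //; exact: descending_sub Nx'.
  have -> : x - x' = a + a' by rewrite xab ba (addrC x') addrA addrK.
  exact: submoduleD.
by move=> [Nxx _]; rewrite -(subrK x' x); exact: submoduleD.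
Qed.

End ChainConditionAdd.

(** * Chain conditions on modules with locally nilpotent scalars *)

Section LocallyNilpotent.
Variables (R : comNzRingType) (V : lmodType R).
Implicit Types (M N : set V) (x : R).

Definition ann_in M x : set V := M `&` [set v | x *: v = 0].

Lemma submodule_ann x : submodule [set v : V | x *: v = 0].
Proof.
apply: submodule_intro => [|u v|a v] /=; first exact: scaler0.
  by move=> u0 v0; rewrite scalerDr u0 v0 addr0.
by move=> v0; rewrite scalerA mulrC -scalerA v0 scaler0.
Qed.

Lemma submodule_ann_in M x : submodule M -> submodule (ann_in M x).
Proof. by move=> sM; apply: submoduleI => //; exact: submodule_ann. Qed.

(* Melkersson: [x ^+ k] embeds the [k]-th layer of [M] into [ann_in M x], so a
   chain in [M] is controlled by a doubly indexed descending family there. *)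
Lemma dcc_torsion M x : submodule M ->
  (forall v, M v -> exists k, x ^+ k *: v = 0) -> dcc (ann_in M x) -> dcc M.
Proof.
move=> sM tors dx N sN Nd NM.
(* The image under [x ^+ k] of the elements of [N j] killed by [x ^+ k.+1]; it decreases in both
   indices. *)
pose L j k := [set w | w \in ann_in M x /\ exists2 v, N j v & w = x ^+ k *: v].
have Lmem j k w : L j k w <->
    x *: w = 0 /\ exists2 v, N j v & w = x ^+ k *: v.
  split=> [[/set_mem[_ xw] ?] //|[xw [v Nv wv]]]; split; last by exists v.
  by apply: mem_set; split=> //; rewrite wv; apply: submoduleZ => //; exact: NM Nv.
have sL j k : submodule (L j k).
  apply: submodule_intro => [|u w|a w]; rewrite !Lmem.
  - split; first exact: scaler0.
    by exists 0; [exact: submodule0|rewrite scaler0].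
  - move=> [u0 [u' Nu uE]] [w0 [w' Nw wE]]; split.
      by rewrite scalerDr u0 w0 addr0.
    by exists (u' + w'); [exact: submoduleD|rewrite uE wE scalerDr].
  - move=> [w0 [w' Nw wE]]; split.
      by rewrite scalerA mulrC -scalerA w0 scaler0.
    by exists (a *: w'); [exact: submoduleZ|rewrite wE !scalerA mulrC].
have LM j k : L j k `<=` ann_in M x by move=> w [/set_mem].
have Lj j j' k : (j <= j')%N -> L j' k `<=` L j k.
  move=> jj w; rewrite !Lmem => -[xw [v Nv wv]]; split=> //.
  by exists v => //; exact: descending_sub Nv.
have Lk j k k' : (k <= k')%N -> L j k' `<=` L j k.
  move=> kk w; rewrite !Lmem => -[xw [v Nv wv]]; split=> //.
  exists (x ^+ (k' - k) *: v); first exact: submoduleZ.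
  by rewrite scalerA -exprD subnKC.
have [|||n0 diag] := dx (fun i => L i i).
- by move=> i; exact: sL.
- by move=> i; apply: subset_trans (Lj _ _ _ (leqnSn i)) (Lk _ _ _ (leqnSn i)).
- by move=> i; exact: LM.
have rows k : exists n, forall j, (n <= j)%N -> L j k = L n k.
  apply: (dx (fun j => L j k)) => //.
  by move=> i; exact: Lj.
have [f fP] := choice rows.
(* The diagonal controls all [L j k] with both indices at least [n0]; only the finitely many rows
   [k < n0] need bounds of their own. *)
pose n := maxn n0 (\max_(k < n0) f k).
have stab j k : (n <= j)%N -> L n k `<=` L j k.
  move=> nj; have [kn0|n0k] := ltnP k n0.
    have fn : (f k <= n)%N.
      rewrite /n leq_max; apply/orP; right.
      exact: (leq_bigmax (F := fun i : 'I_n0 => f i) (Ordinal kn0)).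
    by rewrite (fP k n) // (fP k j) //; exact: leq_trans nj.
  have n0n : (n0 <= n)%N by exact: leq_maxl.
  apply: subset_trans (_ : L n0 n0 `<=` _).
    by apply: subset_trans (Lj _ _ _ n0n) (Lk _ _ _ n0k).
  rewrite -(diag (maxn j k)); last first.
    by rewrite leq_max n0k orbT.
  apply: subset_trans (Lj _ _ _ (leq_maxl j k)) (Lk _ _ _ (leq_maxr j k)).
exists n => j nj; apply/seteqP; split; first exact: descending_sub.
(* Subtracting from [v] an element of [N j] with the same image under a power of [x] lowers by one
   the exponent that kills [v]. *)
suff H k v : N n v -> x ^+ k *: v = 0 -> N j v.
  by move=> v Nv; have [k xv] := tors _ (NM _ _ Nv); exact: H xv.
elim: k v => [|k IHk] v Nv.
  by rewrite expr0 scale1r => ->; exact: submodule0.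
rewrite exprS -scalerA => xv.
have /stab : L n k (x ^+ k *: v) by rewrite Lmem; split=> //; exists v.
move=> /(_ _ nj); rewrite Lmem => -[_ [u Nu vu]].
rewrite -(subrK u v); apply: submoduleD => //; apply: IHk.
  by apply: submoduleB => //; exact: descending_sub Nu.
by rewrite scalerBr vu subrr.
Qed.

(** With [xs] generating the maximal ideal, this reduces the chain condition to the socle. *)
Lemma dcc_torsion_seq M (xs : seq R) : submodule M ->
  (forall x, x \in xs -> forall v, M v -> exists k, x ^+ k *: v = 0) ->
  dcc (M `&` [set v | forall x, x \in xs -> x *: v = 0]) -> dcc M.
Proof.
elim: xs M => [|x xs IHxs] M sM tors dM.
  by apply: dcc_sub dM => v Mv; split.
apply: (@dcc_torsion _ x) => //; first by apply: tors; rewrite mem_head.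
apply: IHxs; first exact: submodule_ann_in.
  by move=> y yxs v [Mv _]; apply: tors => //; rewrite inE yxs orbT.
apply: dcc_sub dM => v [[Mv xv] xsv]; split=> // y.
by rewrite inE => /orP[/eqP->|]; [exact: xv|exact: xsv].
Qed.

(** The lines spanned by [x ^+ k *: v] stabilise, so [x ^+ n *: v] is fixed by some [c * x], and
    [1 - c * x] is a unit. *)
Lemma artinian_torsion m x : artinian V -> is_local m -> m x ->
  forall v : V, exists k, x ^+ k *: v = 0.
Proof.
move=> art lm mx v.
have [||n st] := art (fun k => line (x ^+ k *: v)).
- by move=> k; exact: submodule_line.
- move=> k; apply: line_min; first exact: submodule_line.
  by rewrite exprS -scalerA; exists x.
have : line (x ^+ n.+1 *: v) (x ^+ n *: v) by rewrite st //; exact: line_mem.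
move=> [c _]; rewrite exprS scalerA mulrA -scalerA => e.
exists n.
have nm : ~ m (1 - c * x).
  have idm := prime_ideal_ideal (local_prime lm) => m1.
  apply: (prime1 (local_prime lm)); rewrite -(subrK (c * x) 1).
  by apply: idealD => //; exact: idealM.
have [y y1] := local_unit lm nm.
rewrite -[_ *: v]scale1r -y1 -scalerA scalerBl scale1r.
by rewrite e subrr scaler0.
Qed.

(** Every nonzero vector of the line is a unit multiple of [v], so the line is zero or simple. *)
Lemma dcc_line_simple m (v : V) : is_local m ->
  (forall x, m x -> x *: v = 0) -> dcc (line v).
Proof.
move=> lm mv N sN Nd NM.
have dich i : N i = [set 0] \/ N i = line v.
  have [h|/existsNP[w /not_implyP[Nw w0]]] := pselect (forall w, N i w -> w = 0).
    by left; apply/seteqP; split=> // w ->; exact: submodule0.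
  right; apply/seteqP; split; first exact: NM.
  have [r _ rv] := NM _ _ Nw; apply: line_min => //.
  have nmr : ~ m r by move=> /mv r0; apply: w0; rewrite -rv.
  have [y yr] := local_unit lm nmr.
  by rewrite -[v]scale1r -yr -scalerA rv; exact: submoduleZ.
have [[n Nn]|h] := pselect (exists n, N n = [set 0]).
  exists n => k nk; apply/seteqP; split; first exact: descending_sub.
  by rewrite Nn => _ ->; exact: submodule0.
exists 0%N => k _; have [Nk|->] := dich k; first by case: h; exists k.
by have [N0|->//] := dich 0%N; case: h; exists 0%N.
Qed.

Lemma dcc_lincomb m (s : seq V) : is_local m ->
  (forall v, v \in s -> forall x, m x -> x *: v = 0) -> dcc (lincomb setT s).
Proof.
move=> lm; elim: s => [_|v s IHs ms]; first exact: dcc_set0.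
apply: (@dcc_sub _ _ _ (submod_add (line v) (lincomb setT s))).
  move=> _ [a [y [_ sy ->]]]; exists (a *: v), y; split=> //; by exists a.
apply: dcc_add.
- exact: submodule_line.
- by rewrite lincombT_span; exact: span_submodule.
- by apply: (dcc_line_simple lm) => x mx; apply: ms; rewrite ?mem_head.
- by apply: IHs => w ws; apply: ms; rewrite inE ws orbT.
Qed.

End LocallyNilpotent.

Section Nakayama.
Variables (R : comNzRingType) (V : lmodType R).
Implicit Types (p : set R) (N : set V) (s : seq V).

Lemma submodule_lincomb p s : ideal p -> submodule (lincomb p s).
Proof.
move=> idp; elim: s => [|x t IHt]; first exact: submodule_set0.
apply: submodule_intro.
- exists 0, 0; split; [exact: ideal0|exact: submodule0|].
  by rewrite scale0r addr0.
- move=> _ _ [a [y [pa ty ->]]] [b [z [pb tz ->]]].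
  exists (a + b), (y + z); split; [exact: idealD|exact: submoduleD|].
  by rewrite scalerDl addrACA.
- move=> c _ [a [y [pa ty ->]]]; exists (c * a), (c *: y).
  by split; [exact: idealM|exact: submoduleZ|rewrite scalerDr scalerA].
Qed.

Lemma lincombZ p s c y : ideal p -> p c -> lincomb setT s y ->
  lincomb p s (c *: y).
Proof.
move=> idp pc; elim: s y => [|x s IHs] y /=; first by move->; exact: scaler0.
move=> [a [z [_ sz ->]]]; exists (c * a), (c *: z).
by split; [exact: ideal_mulr|exact: IHs|rewrite scalerDr scalerA].
Qed.

(* Nakayama at the prime [p], by eliminating the generators one by one. *)
Lemma nakayama p N s : prime_ideal p -> submodule N ->
  (forall v, v \in s -> exists2 w, ~ p w & submod_add N (lincomb p s) (w *: v)) ->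
  exists2 w, ~ p w & forall v, v \in s -> N (w *: v).
Proof.
move=> pp sN; have idp := prime_ideal_ideal pp.
elim: s => [|a s IHs] h; first by exists 1 => //; exact: prime1.
have sNs : submodule (submod_add N (lincomb p s)).
  by apply: submodule_add => //; exact: submodule_lincomb.
have [|w npw [n [_ [Nn [c [y [pc sy ->]]] wa]]]] := h a.
  by rewrite mem_head.
(* Moving [c *: a] to the left expresses [a], with denominator [w - c], through the remaining
   generators. *)
have npu : ~ p (w - c).
  by move=> pwc; apply: npw; rewrite -(subrK c w); exact: idealD.
have ua : submod_add N (lincomb p s) ((w - c) *: a).
  by exists n, y; split=> //; rewrite scalerBl wa addrCA addrAC subrr add0r.
have [v vs|w' npw' Nw'] := IHs.
  have [|w' npw' [n' [_ [Nn' [c' [y' [pc' sy' ->]]] w'v]]]] := h v.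
    by rewrite inE vs orbT.
  exists ((w - c) * w'); first exact: primeM.
  rewrite -scalerA w'v scalerDr; apply: submoduleD => //.
    by apply: submod_addl; [exact: submodule_lincomb|exact: submoduleZ].
  rewrite scalerDr scalerA mulrC -scalerA; apply: submoduleD => //.
    exact: submoduleZ.
  apply: submod_addr => //; apply: submoduleZ => //; exact: submodule_lincomb.
exists (w' * (w - c)); first exact: primeM.
move=> v; rewrite inE => /orP[/eqP->|vs]; last first.
  by rewrite mulrC -scalerA; apply: submoduleZ => //; exact: Nw'.
rewrite -scalerA; have [n' [y' [Nn' sy' ->]]] := ua.
rewrite scalerDr; apply: submoduleD => //; first exact: submoduleZ.
have sN' : submodule [set z | N (w' *: z)].
  apply: submodule_intro => [|u z|b u] /=.
  - by rewrite scaler0; exact: submodule0.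
  - by rewrite scalerDr; exact: submoduleD.
  - by rewrite scalerA mulrC -scalerA; exact: submoduleZ.
suff : lincomb setT s `<=` [set z | N (w' *: z)].
  apply; elim: (s) y' sy' => [//|b t IHt] z /= [d [z' [_ tz' ->]]].
  by exists d, z'; split=> //; exact: IHt.
by rewrite lincombT_span; apply: span_min => // z /=; exact: Nw'.
Qed.

End Nakayama.

Section AssociatedPrimes.
Variable R : comNzRingType.
Implicit Types (I J P : set R).

(* A maximal element among the ideals [colon J x] contained in [P] is prime. *)
Lemma minimal_prime_colon J P : noetherian R -> ideal J -> prime_ideal P ->
  J `<=` P -> (forall Q, prime_ideal Q -> J `<=` Q -> Q `<=` P -> P `<=` Q) ->
  exists x, P = colon J x.
Proof.
move=> noeth idJ pP JP Pmin.
pose F := [set I | exists2 x, I = colon J x & I `<=` P].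
have [||_ [x -> xP] xmax] := @noetherian_max _ F noeth.
- by exists (colon J 1), 1 => // r; rewrite /colon /= mulr1; exact: JP.
- by move=> _ [x -> _]; exact: ideal_colon.
have colM c : colon J x `<=` colon J (c * x).
  by move=> r xr; rewrite /colon /= mulrCA; exact: (idealM _ idJ).
have max c : colon J (c * x) `<=` P -> forall r, J (r * (c * x)) -> J (r * x).
  by move=> cP r; apply: (xmax (colon J (c * x))); [exists (c * x)|exact: colM].
exists x; apply/seteqP; split=> //; apply: Pmin => //; last first.
  by move=> r Jr; exact: ideal_mulr.
split; first exact: ideal_colon.
  by move=> /xP/(prime1 pP).
move=> a b abx; apply: contrapT => /not_orP[nax nbx].
have [bP|nbP] := pselect (colon J (b * x) `<=` P).
  by apply/nax/(max b) => //; rewrite mulrA.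
(* Here [c], outside [P], sends [b * x] into [J]. If [colon J (c * x)] escapes [P] as well, through
   [d], then [d * c] lies in [colon J x] although both factors are outside [P]. *)
have [c /not_implyP[cbx npc]] : exists c, ~ (colon J (b * x) c -> P c).
  exact/existsNP.
have [cP|ncP] := pselect (colon J (c * x) `<=` P).
  by apply/nbx/(max c) => //; rewrite mulrCA.
have [d /not_implyP[dcx npd]] : exists d, ~ (colon J (c * x) d -> P d).
  exact/existsNP.
by apply: (primeM pP npd npc); apply: xP; rewrite /colon /= -mulrA.
Qed.

End AssociatedPrimes.

(** * Secondary representations *)

Section AttachedPrimes.
Variables (R : comNzRingType) (V : lmodType R).
Implicit Types (p : set R) (K M N : set V).

(* [V / K] is [p]-secondary; by [AttP] below, the attached primes of an Artinian
   module are those of its secondary quotients. *)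
Definition coprimary p K : Prop :=
  [/\ prime_ideal p, submodule K, K <> setT,
      forall r, ~ p r -> forall x, exists y, K (x - r *: y) &
      forall r, p r -> exists k : nat, forall x, K (r ^+ k *: x)].

Lemma submodule_scale_preimage K r : submodule K ->
  submodule [set x | K (r *: x)].
Proof.
move=> sK; apply: submodule_intro => [|u z|b u] /=.
- by rewrite scaler0; exact: submodule0.
- by rewrite scalerDr; exact: submoduleD.
- by rewrite scalerA mulrC -scalerA; exact: submoduleZ.
Qed.

(** If [p] were none of the [q i], each [M i] would be sent into [K] by a power of some scalar
    outside [p]: when [M i] is not inside [K], divisibility forces [p] into [q i], and an element of
    [q i] outside [p] is nilpotent on [M i]. The product of these powers kills [V / K] but acts
    surjectively on it. *)
Lemma coprimary_cover n (q : 'I_n -> set R) (M : 'I_n -> set V) p K :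
  (forall i, prime_ideal (q i)) ->
  (forall i r, ~ q i r -> forall x, M i x -> exists2 y, M i y & x = r *: y) ->
  (forall i r, q i r -> exists k : nat, forall x, M i x -> r ^+ k *: x = 0) ->
  (forall K', submodule K' -> (forall i, M i `<=` K') -> K' = setT) ->
  coprimary p K -> exists i, p = q i.
Proof.
move=> pq divM nilM gen [pp sK KT divK nilK]; apply: contrapT => /forallNP pNq.
have wit i : exists r (k : nat), ~ p r /\ forall x, M i x -> K (r ^+ k *: x).
  have [MK|nMK] := pselect (M i `<=` K).
    exists 1, 0%N; split=> [|x Mx]; first exact: prime1.
    by rewrite expr0 scale1r; exact: MK.
  have pq_sub : p `<=` q i.
    move=> r pr; apply: contrapT => nqr; apply: nMK => x Mx.
    have [k rk] := nilK _ pr.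
    have nqrk : ~ q i (r ^+ k) by move=> /(primeX (pq i)).
    by have [y _ ->] := divM _ _ nqrk _ Mx.
  have [r [qr npr]] : exists r, q i r /\ ~ p r.
    apply: contrapT => /forallNP h; apply: (pNq i); apply/seteqP; split=> // r qr.
    by apply: contrapT => npr; apply: (h r).
  have [k rk] := nilM _ _ qr; exists r, k; split=> // x /rk ->; exact: submodule0.
have [r rP] := choice wit; have [k rk] := choice rP.
pose s := \prod_i r i ^+ k i.
have nps : ~ p s.
  apply: prime_prod => // i _ /(primeX pp); by have [] := rk i.
have KsT : [set x | K (s *: x)] = setT.
  apply: gen; first exact: submodule_scale_preimage.
  move=> i x Mx /=; rewrite /s (bigD1 i) //= mulrC -scalerA.
  by apply: submoduleZ => //; have [_] := rk i; apply.
apply: KT; apply/seteqP; split=> // x _.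
have [y Kxy] := divK _ nps x; rewrite -(subrK (s *: y) x).
by apply: submoduleD => //; rewrite -[K _]/([set x | K (s *: x)] y) KsT.
Qed.

Lemma submodule_sum_submod n (P : pred 'I_n) (N : 'I_n -> set V) :
  (forall i, submodule (N i)) -> submodule (sum_submod P N).
Proof.
move=> sN; apply: submodule_intro.
- exists (fun=> 0); first by move=> i _; exact: submodule0.
  by rewrite big1.
- move=> _ _ [f fN ->] [g gN ->]; exists (fun i => f i + g i).
    by by move=> i Pi; apply: submoduleD; [exact: sN|exact: fN|exact: gN].
  by rewrite big_split.
- move=> a _ [f fN ->]; exists (fun i => a *: f i).
    by by move=> i Pi; apply: submoduleZ; [exact: sN|exact: fN].
  by rewrite scaler_sumr.
Qed.

Lemma secondary_divisible p N r x : secondary p N -> ~ p r -> N x ->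
  exists2 y, N y & x = r *: y.
Proof.
by case=> _ _ divN _ npr; rewrite -{1}(divN r npr) => -[y Ny <-]; exists y.
Qed.

Lemma secondary_submodule p N : secondary p N -> submodule N.
Proof. by case=> _ []. Qed.

Lemma secondary_add p N M : secondary p N -> secondary p M ->
  secondary p (submod_add N M).
Proof.
move=> sN sM; have [pp [subN N0] _ nilN] := sN; have [_ [subM _] _ nilM] := sM.
have subNM := submodule_add subN subM.
split=> // [|r npr|r pr].
- split=> // NM0; apply: N0; apply/seteqP; split=> [x Nx|_ ->]; last first.
    exact: submodule0.
  by rewrite -NM0; exact: submod_addl.
- apply/seteqP; split=> [_ [x NMx <-]|_ [x [y [Nx My ->]]]].
    exact: submoduleZ.
  have [x' Nx' ->] := secondary_divisible sN npr Nx.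
  have [y' My' ->] := secondary_divisible sM npr My.
  by exists (x' + y'); rewrite ?scalerDr //; exists x', y'.
- have [k rk] := nilN _ pr; have [l rl] := nilM _ pr.
  exists (k + l)%N => _ [x [y [Nx My ->]]]; rewrite scalerDr exprD -!scalerA.
  by rewrite (rl y) // scaler0 addr0 scalerA mulrC -scalerA rk // scaler0.
Qed.

(** Unindexed, so that sums can be concatenated without reindexing; [sec_sum_family] adds the
    indices afterwards. *)
Inductive sec_sum : set V -> Prop :=
| sec_sum0 : sec_sum [set 0]
| sec_sumD p N M : secondary p N -> sec_sum M -> sec_sum (submod_add N M).

Lemma submod_addA N1 N2 N3 :
  submod_add (submod_add N1 N2) N3 = submod_add N1 (submod_add N2 N3).
Proof.
apply/seteqP; split.
  move=> _ [_ [z [[x [y [Nx Ny ->]]] Nz ->]]].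
  by exists x, (y + z); split; rewrite ?addrA //; exists y, z.
move=> _ [x [_ [Nx [y [z [Ny Nz ->]]] ->]]].
by exists (x + y), z; split; rewrite ?addrA //; exists x, y.
Qed.

Lemma submod_add0 N : submod_add [set 0] N = N.
Proof.
apply/seteqP; split=> [_ [_ [x [-> Nx ->]]]|x Nx]; first by rewrite add0r.
by exists 0, x; rewrite add0r.
Qed.

Lemma sec_sum_add M1 M2 : sec_sum M1 -> sec_sum M2 -> sec_sum (submod_add M1 M2).
Proof.
move=> + s2; elim=> [|p N M sN _ IH]; first by rewrite submod_add0.
by rewrite submod_addA; exact: sec_sumD sN IH.
Qed.

(* A module that is not a sum of two proper submodules is secondary. *)
Lemma artinian_sec_sum : artinian V -> sec_sum setT.
Proof.
move=> art; apply: contrapT => nT.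
pose F := [set M : set V | submodule M /\ ~ sec_sum M].
have [||M [sM nM] Mmin] := @dcc_min _ _ F art.
- by exists setT; split=> //; exact: submodule_setT.
- by move=> N [].
have proper N : submodule N -> N `<=` M -> sec_sum N \/ N = M.
  move=> sN NM; have [|nN] := pselect (sec_sum N); [by left|right].
  exact: Mmin.
(* Fitting's argument: once the images of the powers of [r] stabilise at [n], [M] is the sum of the
   image and the kernel of [r ^+ n], so one of these is all of [M]. *)
have dich r : (forall x, M x -> exists2 y, M y & x = r *: y) \/
    exists k, forall x, M x -> r ^+ k *: x = 0.
  have sI k : submodule [set r ^+ k *: x | x in M].
    apply: submodule_intro => [|_ _ [x Mx <-] [y My <-]|a _ [x Mx <-]].
    - by exists 0; [exact: submodule0|rewrite scaler0].
    - by exists (x + y); [exact: submoduleD|rewrite scalerDr].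
    - by exists (a *: x); [exact: submoduleZ|rewrite !scalerA mulrC].
  have [|n st] := art (fun k => [set r ^+ k *: x | x in M]) sI.
    move=> k _ [x Mx <-]; exists (r *: x); first exact: submoduleZ.
    by rewrite scalerA -exprSr.
  have IM : [set r ^+ n *: x | x in M] `<=` M.
    by move=> _ [x Mx <-]; exact: submoduleZ.
  have sK := submodule_ann_in (r ^+ n) sM.
  have KM : ann_in M (r ^+ n) `<=` M by move=> x [].
  have sumM : submod_add [set r ^+ n *: x | x in M] (ann_in M (r ^+ n)) = M.
    apply/seteqP; split; first by apply: submod_add_min.
    move=> x Mx; have : [set r ^+ (n + n) *: y | y in M] (r ^+ n *: x).
      by rewrite st ?leq_addr //; exists x.
    move=> [y My e0].
    have e : r ^+ n *: (r ^+ n *: y) = r ^+ n *: x by rewrite scalerA -exprD.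
    exists (r ^+ n *: y), (x - r ^+ n *: y); split.
    - by exists y.
    - split; first by apply: submoduleB => //; exact: submoduleZ.
      by rewrite /= scalerBr e subrr.
    - by rewrite addrC subrK.
  have [sI'|IE] := proper _ (sI n) IM.
    have [sK'|KE] := proper _ sK KM.
      by case: nM; rewrite -sumM; exact: sec_sum_add.
    by right; exists n => x; rewrite -{1}KE => -[].
  left=> x; rewrite -{1}IE -(st n.+1) // => -[y My <-].
  by exists (r ^+ n *: y); [exact: submoduleZ|rewrite scalerA -exprS].
have M0 : M <> [set 0] by move=> E; apply: nM; rewrite E; exact: sec_sum0.
have M0' : ~ forall x, M x -> x = 0.
  move=> h; apply: M0; apply/seteqP; split=> // _ ->; exact: submodule0.
apply: nM; rewrite -(submod_add0 M).
have comm : submod_add [set 0] M = submod_add M [set 0].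
  by apply/seteqP; split=> _ [x [y [Nx Ny ->]]]; exists y, x; rewrite addrC.
rewrite comm; pose p := [set r | exists k, forall x, M x -> r ^+ k *: x = 0].
have divp r : ~ p r -> forall x, M x -> exists2 y, M y & x = r *: y.
  by have [|] := dich r.
apply: (@sec_sumD p); last exact: sec_sum0.
split=> //.
- split.
  + apply: ideal_intro.
    * by exists 1%N => x _; rewrite expr1 scale0r.
    * move=> a b [k ak] [l bl]; exists (k + l)%N => x Mx.
      rewrite exprDn scaler_suml big1 // => i _; rewrite -scalerMnl.
      have [ki|] := leqP k (k + l - i).
        rewrite -(subnKC ki) exprD -mulrA mulrC -scalerA.
        by rewrite ak // scaler0 mul0rn.
      move=> lt; have li : (l <= i)%N.
        rewrite leqNgt; apply/negP => /ltnW il.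
        by move: lt; rewrite ltnNge -addnBA // leq_addr.
      rewrite -(subnKC li) [b ^+ (_ + _)]exprD mulrA mulrAC -scalerA.
      by rewrite bl // scaler0 mul0rn.
    * move=> a b [k bk]; exists k => x Mx.
      by rewrite exprMn -scalerA bk // scaler0.
  + by move=> [k]; rewrite expr1n => h; apply: M0' => x /h; rewrite scale1r.
  + move=> a b [k abk]; apply: contrapT => /not_orP[na nb].
    have powdiv : forall j x, M x -> exists2 y, M y & x = (a * b) ^+ j *: y.
      elim=> [|j IHj] x Mx; first by exists x; rewrite ?expr0 ?scale1r.
      have [y My ->] := IHj _ Mx; have [z Mz ->] := divp _ na _ My.
      have [t Mt ->] := divp _ nb _ Mz; exists t => //.
      by rewrite !scalerA exprSr mulrA.
    by apply: M0' => x Mx; have [y My ->] := powdiv k _ Mx; exact: abk.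
- move=> r npr; apply/seteqP; split=> [_ [x Mx <-]|x Mx]; first exact: submoduleZ.
  by have [y My ->] := divp _ npr _ Mx; exists y.
Qed.

Lemma sec_sum_family M : sec_sum M -> exists n (p : 'I_n -> set R) (N : 'I_n -> set V),
  (forall i, secondary (p i) (N i)) /\ sum_submod xpredT N = M.
Proof.
elim=> [|p N M' sN _ [n [q [L [sL LM]]]]].
  exists 0%N, (fun=> set0), (fun=> set0); split; first by case.
  apply/seteqP; split=> [_ [f _ ->]|_ ->]; first by rewrite big_ord0.
  by exists (fun=> 0); [case|rewrite big_ord0].
exists n.+1, (fun i => if unlift ord0 i is Some j then q j else p),
  (fun i => if unlift ord0 i is Some j then L j else N); split.
  by move=> i; case: unliftP.
apply/seteqP; split=> [_ [f fN ->]|_ [x [y [Nx My ->]]]].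
  rewrite big_ord_recl; exists (f ord0), (\sum_(i < n) f (lift ord0 i)).
  split=> //; first by have := fN ord0 isT; rewrite unlift_none.
  rewrite -LM; exists (fun i => f (lift ord0 i)) => // i _.
  by have := fN (lift ord0 i) isT; rewrite liftK.
move: My; rewrite -LM => -[f fL ->].
exists (fun i => if unlift ord0 i is Some j then f j else x).
  by move=> i _; case: unliftP => // j _; exact: fL.
rewrite big_ord_recl unlift_none; congr (_ + _).
by apply: eq_bigr => i _; rewrite liftK.
Qed.

(** A representation with the fewest terms is irredundant, and its primes are distinct because two
    components with the same prime could be merged. *)
Lemma artinian_min_secondary_repr : artinian V ->
  exists n (p : 'I_n -> set R) (N : 'I_n -> set V), min_secondary_repr p N.
Proof.
move=> art.
pose rep n := `[< exists (p : 'I_n -> set R) (N : 'I_n -> set V),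
  (forall i, secondary (p i) (N i)) /\ sum_submod xpredT N = [set: V] >].
have ex_rep : exists n, rep n.
  have [n [p [N h]]] := sec_sum_family (artinian_sec_sum art).
  by exists n; apply/asboolP; exists p, N.
case: (ex_minnP ex_rep) => n /asboolP[p [N [sN NT]]] nmin.
exists n, p, N; split=> //.
  case: n p N sN NT nmin => [|n] p N sN NT nmin j; first by case: j.
  move=> jT; suff : (n < n)%N by rewrite ltnn.
  apply: nmin; apply/asboolP; exists (p \o lift j), (N \o lift j).
  split=> [i|]; first exact: sN.
  apply/seteqP; split=> // x; rewrite -jT => -[f fN ->].
  exists (f \o lift j); first by move=> i _; apply: fN; rewrite /= eq_sym neq_lift.
  rewrite big_mkcond (bigD1_ord j) //= eqxx add0r.
  by apply: eq_bigr => i _; rewrite eq_sym neq_lift.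
case: n p N sN NT nmin => [|n] p N sN NT nmin i j; first by case: i.
move=> pij; apply/eqP; apply: contrapT => /negP nij.
suff : (n < n)%N by rewrite ltnn.
apply: nmin; apply/asboolP; exists (p \o lift j).
have [i' iE|iE] := unliftP j i; last by rewrite iE eqxx in nij.
exists (fun k => if k == i' then submod_add (N i) (N j) else N (lift j k)).
split=> [k|].
  case: eqVneq => [->|_] /=; last exact: sN.
  by rewrite -iE; apply: secondary_add; [exact: sN|rewrite pij; exact: sN].
apply/seteqP; split=> // x; rewrite -NT => -[f fN ->].
exists (fun k => f (lift j k) + if k == i' then f j else 0).
  move=> k _; case: eqVneq => [->|_]; last by rewrite addr0; exact: fN.
  by exists (f i), (f j); rewrite -iE; split=> //; exact: fN.
rewrite (bigD1_ord j) //= big_split /= addrC; congr (_ + _).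
by rewrite -big_mkcond big_pred1_eq.
Qed.

(** [K] is the sum of the other components, proper by irredundancy, so [V / K] is a nonzero quotient
    of a secondary module. *)
Lemma Att_coprimary p : Att V p -> exists K, coprimary p K.
Proof.
move=> [n [q [N [[sN NT Nirr _] [i ->]]]]].
have subN j : submodule (N j) by exact: secondary_submodule (sN j).
have split_i x : exists a b, [/\ N i a, sum_submod (predC1 i) N b & x = a + b].
  have : [set: V] x by []; rewrite -NT => -[f fN ->].
  rewrite (bigD1 i) //=; exists (f i), (\sum_(j | j != i) f j).
  by split=> //; [exact: fN|exists f => // j _; exact: fN].
exists (sum_submod (predC1 i) N).
have sK := submodule_sum_submod (predC1 i) subN.
have [pq _ _ nil] := sN i; split=> // [r npr x|r pr].
  have [a [b [Na Kb ->]]] := split_i x.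
  have [a' _ ->] := secondary_divisible (sN i) npr Na.
  by exists a'; rewrite addrAC subrr add0r.
have [k rk] := nil _ pr; exists k => x; have [a [b [Na Kb ->]]] := split_i x.
by rewrite scalerDr rk // add0r; exact: submoduleZ.
Qed.

Lemma min_secondary_cover n (q : 'I_n -> set R) (N : 'I_n -> set V) p K :
  min_secondary_repr q N -> coprimary p K -> exists i, p = q i.
Proof.
move=> [sN NT _ _]; apply: (@coprimary_cover n q N).
- by move=> i; case: (sN i).
- by move=> i r nqr x; exact: secondary_divisible (sN i) nqr.
- by move=> i r; have [_ _ _ nil] := sN i; exact: nil.
- move=> K' sK' NK'; apply/seteqP; split=> // x; rewrite -NT => -[f fN ->].
  by apply: submodule_sum => // i _; apply: (NK' i); exact: fN.
Qed.

Lemma AttP p : artinian V -> Att V p <-> exists K, coprimary p K.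
Proof.
move=> art; split=> [/Att_coprimary //|[K cK]].
have [n [q [N NV]]] := artinian_min_secondary_repr art.
by exists n, q, N; split=> //; exact: (min_secondary_cover NV cK).
Qed.

(** If no [q i] lay in [Q], a product of powers of elements of the [q i] outside [Q] would
    annihilate [V]. *)
Lemma prime_over_ann Q : artinian V -> prime_ideal Q -> ann V `<=` Q ->
  exists2 p, Att V p & p `<=` Q.
Proof.
move=> art pQ annQ; have [n [q [N NV]]] := artinian_min_secondary_repr art.
have [sN NT _ _] := NV.
suff [i qQ] : exists i, q i `<=` Q.
  by exists (q i) => //; exists n, q, N; split=> //; exists i.
apply: contrapT => /forallNP h.
have wit i : exists r (k : nat), ~ Q r /\ forall x, N i x -> r ^+ k *: x = 0.
  have [r [qr nQr]] : exists r, q i r /\ ~ Q r.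
    apply: contrapT => /forallNP h'; apply: (h i) => r qr.
    by apply: contrapT => nQr; apply: (h' r).
  have [_ _ _ nil] := sN i; have [k rk] := nil _ qr; by exists r, k.
have [r rP] := choice wit; have [k rk] := choice rP.
have : ~ Q (\prod_i r i ^+ k i).
  by apply: prime_prod => // i _ /(primeX pQ); have [] := rk i.
apply; apply: annQ => x; have : [set: V] x by [].
rewrite -NT => -[f fN ->]; rewrite scaler_sumr big1 // => i _.
rewrite (bigD1 i) //= mulrC -scalerA; have [_ ->] := rk i; rewrite ?scaler0 //.
exact: fN.
Qed.

End AttachedPrimes.

(** * Module-finite extensions *)

Section QuotientRing.
Variables (R : comNzRingType) (I : set R).
Hypothesis idI : ideal I.

Definition residue (x : R) : quot_ring I := quot_pi (I : set R^o) x.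

Lemma residue_eq x y : residue x = residue y <-> I (x - y).
Proof. by rewrite -{2}(span_id idI); exact: quot_piP. Qed.

Lemma residueB : {morph residue : x y / x - y}.
Proof. exact: (@quot_piB R R^o I). Qed.

Lemma residueM : {morph residue : x y / x * y}.
Proof. by move=> x y; rewrite -[RHS]/(quot_mul _ _) quot_mulE. Qed.

Lemma residue_surj (z : quot_ring I) : exists x, residue x = z.
Proof. by exists (quot_repr z); exact: quot_reprK. Qed.

Lemma residueD : {morph residue : x y / x + y}.
Proof. exact: (raddfD (quot_pi (I : set R^o))). Qed.

Lemma residue_eq0 x : residue x = 0 <-> I x.
Proof. by rewrite -(subrr (residue 0)) -residueB subr0 residue_eq subr0. Qed.

End QuotientRing.

Section KrullDim.
Variable R : comNzRingType.
Implicit Types (I J : set R).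

(** Primes of [R / I] are read as primes of [R] above [I], so that dimensions are compared without
    passing to residue classes. *)
Definition chain_lengths I : set nat :=
  [set n | exists2 p : nat -> set R,
     forall i, (i <= n)%N -> prime_ideal (p i) /\ I `<=` p i &
     forall i, (i < n)%N -> p i `<` p i.+1].

Lemma ideal_residue_preimage I (q : set (quot_ring I)) : ideal I ->
  prime_ideal q -> prime_ideal (@residue R I @^-1` q) /\
  I `<=` @residue R I @^-1` q.
Proof.
move=> idI [/submoduleP[q0 ql] q1 qM]; split; last first.
  by move=> x /(residue_eq0 idI) x0; rewrite /preimage /= x0.
split.
- apply: ideal_intro => [|x y qx qy|a x qx]; rewrite /preimage /=.
  + by have -> : residue I 0 = 0 by apply/residue_eq0 => //; exact: ideal0.
  + by rewrite residueD -[residue I x]mul1r; exact: ql.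
  + by rewrite residueM -[X in q X]addr0; exact: ql.
- exact: q1.
- by move=> x y; rewrite /preimage /= residueM; exact: qM.
Qed.

Lemma residue_image I (p : set R) x : ideal I -> prime_ideal p -> I `<=` p ->
  (@residue R I @` p) (residue I x) <-> p x.
Proof.
move=> idI pp Ip; split=> [[y py /(residue_eq idI)Iyx]|px]; last by exists x.
rewrite -(subKr y x); apply: idealB => //; first exact: prime_ideal_ideal.
exact: Ip.
Qed.

Lemma prime_residue_image I (p : set R) : ideal I -> prime_ideal p -> I `<=` p ->
  prime_ideal (@residue R I @` p).
Proof.
move=> idI pp Ip; have [idp p1 pM] := pp.
have im x : (@residue R I @` p) (residue I x) <-> p x by exact: residue_image.
split.
- apply/submoduleP; split.
    have <- : residue I 0 = 0 by apply/residue_eq0 => //; exact: ideal0.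
    by exists 0 => //; exact: ideal0.
  move=> a _ _ [x px <-] [y py <-]; have [b <-] := residue_surj a.
  exists (b * x + y); first by apply: idealD => //; exact: idealM.
  by rewrite residueD residueM.
- by move=> /im.
- move=> a b; have [x <-] := residue_surj a; have [y <-] := residue_surj b.
  by rewrite -residueM !im; exact: pM.
Qed.

Lemma krull_dim_quot_ring I : ideal I -> krull_dim (quot_ring I) =
  supremum -oo%E [set (n%:Z)%:E%E | n in chain_lengths I].
Proof.
move=> idI; rewrite /krull_dim; congr (supremum _ [set _ | n in _]).
apply/seteqP; split=> n [p pp pS].
  exists (fun i => @residue R I @^-1` p i).
    by move=> i /pp; exact: ideal_residue_preimage.
  move=> i /pS[sub nsub]; split=> [x /sub //|sub']; apply: nsub => z.
  by have [x <-] := residue_surj z; exact: sub'.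
exists (fun i => @residue R I @` p i).
  by move=> i /pp[? ?]; exact: prime_residue_image.
move=> i lin; have [sub nsub] := pS i lin; split.
  by move=> _ [x px <-]; exists x => //; exact: sub.
have [pi Ii] := pp i (ltnW lin); have [pi1 Ii1] := pp i.+1 lin.
move=> sub'; apply: nsub => x px; apply/(residue_image _ idI pi Ii).
by apply: sub'; exists x.
Qed.

Lemma ideal_ann (V : lmodType R) : ideal (ann V).
Proof.
apply: ideal_intro => [|a b a0 b0|a b b0] x.
- exact: scale0r.
- by rewrite scalerDl a0 b0 addr0.
- by rewrite -scalerA b0 scaler0.
Qed.

Lemma quot_mod_eq0 J (x : R^o) : ideal J ->
  quot_pi (J : set R^o) x = 0 <-> J x.
Proof. by move=> idJ; exact: (residue_eq0 idJ x). Qed.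

Lemma quot_mod_scale J r (x : R) :
  r *: quot_pi (J : set R^o) x = quot_pi (J : set R^o) (r * x).
Proof. by rewrite -(quot_pi_scalable (J : set R^o)). Qed.

Lemma ann_quot_mod J : ideal J -> ann (quot_mod (J : set R^o)) = J.
Proof.
move=> idJ; apply/seteqP; split=> r.
  move=> /(_ (quot_pi (J : set R^o) 1)).
  by rewrite quot_mod_scale mulr1 => /(quot_mod_eq0 _ idJ).
move=> Jr x; rewrite -(quot_reprK x) quot_mod_scale.
by apply/quot_mod_eq0 => //; exact: ideal_mulr.
Qed.

Lemma AssE J P : ideal J ->
  Ass (quot_mod (J : set R^o)) P <-> prime_ideal P /\ exists x, P = colon J x.
Proof.
move=> idJ; split=> -[pP [x PE]]; split=> //; rewrite PE.
  exists (quot_repr x); apply/seteqP; split=> r; rewrite /colon /=.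
    by rewrite -{1}(quot_reprK x) quot_mod_scale => /(quot_mod_eq0 _ idJ).
  move=> Jr; rewrite -(quot_reprK x) quot_mod_scale.
  exact/(quot_mod_eq0 _ idJ).
exists (quot_pi (J : set R^o) x); apply/seteqP.
by split=> r; rewrite /colon /= quot_mod_scale => /(quot_mod_eq0 _ idJ).
Qed.

Lemma AsshE J P : ideal J -> Assh (quot_mod (J : set R^o)) P <->
  [/\ prime_ideal P, exists x, P = colon J x &
      krull_dim (quot_ring P) = krull_dim (quot_ring J)].
Proof.
move=> idJ; rewrite /Assh /= AssE // /mdim ann_quot_mod //.
by split=> [[[]]|[]].
Qed.

End KrullDim.

(** * Integrality, incomparability, going up *)

Section FiniteExtension.
Variables (R S : comNzRingType) (phi : {rmorphism R -> S}).
Implicit Types (p : set R) (J P Q : set S).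

Lemma submodule_restr (B : lmodType S) (N : set B) :
  submodule N -> submodule (N : set (restr phi B)).
Proof.
move=> sN; apply: submodule_intro; first exact: (submodule0 sN).
  by move=> x y; exact: (@submoduleD S B).
by move=> a x; exact: (@submoduleZ S B).
Qed.

Lemma ideal_contraction J : ideal J -> ideal (contraction phi J).
Proof.
move=> idJ; apply: ideal_intro => [|x y Jx Jy|a x Jx];
  rewrite /contraction /preimage /=.
- by rewrite rmorph0; exact: ideal0.
- by rewrite rmorphD; exact: idealD.
- by rewrite rmorphM; exact: idealM.
Qed.

Lemma prime_contraction P : prime_ideal P -> prime_ideal (contraction phi P).
Proof.
move=> [idP P1 PM]; split; first exact: ideal_contraction.
  by rewrite /contraction /preimage /= rmorph1.
by move=> x y; rewrite /contraction /preimage /= rmorphM; exact: PM.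
Qed.

Lemma ideal_ideal_ext p : ideal (ideal_ext phi p).
Proof. exact: span_submodule. Qed.

Lemma ideal_ext_mem p r : p r -> ideal_ext phi p (phi r).
Proof. by move=> pr; apply: (@sub_span S S^o); exists r. Qed.

Lemma ideal_ext_sub p J : ideal J -> p `<=` contraction phi J ->
  ideal_ext phi p `<=` J.
Proof.
move=> idJ pJ; apply: (@span_min S S^o) => // _ [r pr <-]; exact: pJ.
Qed.

Hypothesis finS : fin_gen [set: restr phi S^o].

Lemma restr_lincomb :
  exists s : seq (restr phi S^o), forall x, lincomb setT s x.
Proof.
by have [s sT] := finS; exists s => x; rewrite lincombT_span -sT.
Qed.

Lemma lincomb_coef (s : seq (restr phi S^o)) y : lincomb setT s y ->
  exists c : nat -> R, (y : S) = \sum_(i < size s) phi (c i) * s`_i.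
Proof.
elim: s y => [|x s IHs] y /=; first by move=> ->; exists (fun=> 0); rewrite big_ord0.
move=> [a [z [_ /IHs[c zE] ->]]].
exists (fun i => if i is j.+1 then c j else a).
by rewrite big_ord_recl /= -zE.
Qed.

(** Determinant trick: multiplication by [x] acts on the generators through a matrix over [R], and
    the characteristic polynomial of that matrix vanishes at [x]. *)
Lemma integral_equation (x : S) : exists d (a : nat -> R),
  x ^+ d + \sum_(i < d) phi (a i) * x ^+ i = 0.
Proof.
have [s sT] := restr_lincomb; set t := size s.
have coef y : exists c : nat -> R, y = \sum_(i < t) phi (c i) * (s`_i : S).
  exact: lincomb_coef (sT y).
have [a aE] := choice (fun i : 'I_t => coef (x * (s`_i : S))).
pose A : 'M[R]_t := \matrix_(i, j) a i j.
pose M : 'M[S]_t := x%:M - map_mx phi A.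
pose e : 'cV[S]_t := \col_i (s`_i : S).
have Me : M *m e = 0.
  apply/matrixP => i j; rewrite mulmxBl mul_scalar_mx !mxE.
  rewrite aE -sumrB big1 // => k _; rewrite !mxE subrr //.
have detMe i : (i < t)%N -> \det M * (s`_i : S) = 0.
  move=> it; have := congr1 (mulmx (\adj M)) Me.
  rewrite mulmxA mul_adj_mx mul_scalar_mx mulmx0.
  by move=> /matrixP/(_ (Ordinal it) ord0); rewrite !mxE.
(* The determinant kills every generator, and [1] is a combination of generators. *)
have det0 : \det M = 0.
  rewrite -[\det M]mulr1; have [c ->] := coef 1.
  by rewrite mulr_sumr big1 // => i _; rewrite mulrCA detMe ?mulr0.
have : (map_poly phi (char_poly A)).[x] = 0.
  rewrite map_char_poly -det0 /char_poly -[LHS]/(horner_eval x _) -det_map_mx.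
  congr (\det _); apply/matrixP => i j; rewrite !mxE.
  rewrite -[LHS]/(('X *+ (i == j) - (phi (a i j))%:P).[x]).
  by rewrite hornerD hornerN hornerC hornerMn hornerX.
have mon : map_poly phi (char_poly A) \is monic.
  by apply: monic_map; exact: char_poly_monic.
have sz : size (map_poly phi (char_poly A)) = t.+1.
  by rewrite map_char_poly size_char_poly.
rewrite horner_coef sz big_ord_recr /= => E.
exists t, (fun i => (char_poly A)`_i); rewrite addrC -[RHS]E; congr (_ + _).
  by apply: eq_bigr => i _; rewrite coef_map.
by move/monicP: mon; rewrite /lead_coef sz /= => ->; rewrite mul1r.
Qed.

(** In a monic relation for [x] modulo [P] the constant term lies in [Q], hence in [P] by the
    hypothesis on contractions; since [P] is prime, either [x] is in [P] or a factor [x] cancels and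
    the degree drops. In degree 0 the relation would put [1] in [P]. *)
Lemma incomparable P Q : prime_ideal P -> ideal Q ->
  contraction phi Q `<=` contraction phi P -> P `<=` Q -> Q `<=` P.
Proof.
move=> pP idQ QP PQ x Qx; have idP := prime_ideal_ideal pP.
have [d [a E]] := integral_equation x.
have : P (x ^+ d + \sum_(i < d) phi (a i) * x ^+ i) by rewrite E; exact: ideal0.
elim: d a {E} => [|d IHd] a.
  by rewrite expr0 big_ord0 addr0 => /(prime1 pP).
rewrite big_ord_recl expr0 mulr1.
have -> : x ^+ d.+1 + (phi (a 0%N) + \sum_(i < d) phi (a (lift ord0 i)) * x ^+ lift ord0 i)
    = phi (a 0%N) + (x ^+ d + \sum_(i < d) phi (a i.+1) * x ^+ i) * x.
  rewrite addrCA mulrDl -exprSr mulr_suml; congr (_ + (_ + _)).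
  by apply: eq_bigr => i _; rewrite -mulrA -exprSr.
move=> Pfx; have Pa0 : P (phi (a 0%N)).
  apply: QP; rewrite /contraction /preimage /=.
  have := PQ _ Pfx; set y := (_ * x) => Qy.
  rewrite -[phi _](addrK y); apply: idealB => //; exact: idealM.
have : P ((x ^+ d + \sum_(i < d) phi (a i.+1) * x ^+ i) * x).
  by rewrite -[_ * x](addKr (phi (a 0%N))) addrC; exact: idealB.
have [_ _ PM] := pP => /PM[] //; exact: (IHd (fun i => a i.+1)).
Qed.

(* Lying over and going up at once: [J + pS] avoids [phi (R \ p)] by Nakayama
   at [p]. *)
Lemma going_up J p : ideal J -> prime_ideal p -> contraction phi J `<=` p ->
  exists P, [/\ prime_ideal P, J `<=` P & contraction phi P = p].
Proof.
move=> idJ pp Jp; have idp := prime_ideal_ideal pp.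
have [s sT] := restr_lincomb.
have extS y v : ideal_ext phi p y -> lincomb p s (y * v : S).
  pose Y : set S := [set y | forall v : S, lincomb p s (y * v : S)].
  suff h : ideal_ext phi p `<=` Y by move=> /h; exact.
  have sl : submodule (lincomb p s) by exact: submodule_lincomb.
  apply: (@span_min S S^o).
    apply: ideal_intro => [w|u w Yu Yw z|a u Yu z].
    - by rewrite mul0r; exact: (submodule0 sl).
    - rewrite mulrDl; exact: (@submoduleD _ (restr phi S^o) _ _ _ sl).
    - by rewrite mulrAC mulrC; exact: Yu.
  by move=> _ [c pc <-] w; apply: (lincombZ idp pc); exact: sT.
have idE := ideal_ideal_ext p.
have avoid x : submod_add (J : set S^o) (ideal_ext phi p) x ->
    ~ [set phi r | r in ~` p] x.
  move=> [j [y [Jj Ey ->]]] [r npr rE].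
  (* Nakayama yields [w] outside [p] with [phi w * S] inside [J]; applied to [1] this puts [w] in
     the contraction of [J], hence in [p]. *)
  have [|v vs|w npw Jw] := @nakayama R (restr phi S^o) p J s pp.
  - exact: submodule_restr.
  - exists r => //; exists (j * v), (y * v); split.
    + exact: ideal_mulr.
    + exact: extS.
    + by rewrite -[LHS]/(phi r * (v : S)) rE mulrDl.
  apply: npw; apply: Jp; rewrite /contraction /preimage /= -[phi w]mulr1.
  have sJ : submodule [set v : restr phi S^o | J (phi w * (v : S))].
    apply: submodule_intro => [|u z Ju Jz|b u Ju] /=.
    - by rewrite mulr0; exact: ideal0.
    - by rewrite mulrDr; exact: idealD.
    - by rewrite -[b *: u]/(phi b * (u : S)) mulrCA; exact: idealM.
  have : lincomb setT s (1 : S) by [].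
  rewrite lincombT_span; apply: (span_min sJ) => z zs; exact: Jw.
have [|||P [pP sub PD]] := @prime_avoiding S _ _ _ avoid.
- exact: submodule_add.
- by exists 1; [exact: prime1|rewrite rmorph1].
- move=> _ _ [x npx <-] [y npy <-]; exists (x * y); last by rewrite rmorphM.
  exact: primeM.
exists P; split=> //.
  by apply: subset_trans sub; exact: (@submod_addl S S^o _ _ idE).
apply/seteqP; split=> r.
  by move=> Pr; apply: contrapT => npr; apply: (PD _ Pr); exists r.
move=> pr; apply: sub; apply: (@submod_addr S S^o _ _ idJ); exact: ideal_ext_mem.
Qed.

Lemma lying_over p : injective phi -> prime_ideal p ->
  exists2 P, prime_ideal P & contraction phi P = p.
Proof.
move=> phi_inj pp.
have id0 : ideal [set 0 : S] by exact: (@submodule_set0 S S^o).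
have [|P [pP _ PE]] := going_up id0 pp; last by exists P.
move=> r /=; rewrite -(rmorph0 phi) => /phi_inj ->.
exact: ideal0 (prime_ideal_ideal pp).
Qed.

(** Contracted chains stay strict by incomparability; chains of [R] are lifted from the bottom by
    going up, one prime at a time. *)
Lemma chain_lengths_contraction J : ideal J ->
  chain_lengths (contraction phi J) = chain_lengths J.
Proof.
move=> idJ; apply/seteqP; split=> n [q qP qS]; last first.
  exists (fun i => contraction phi (q i)).
    move=> i /qP[pq Jq]; split; first exact: prime_contraction.
    by move=> r /Jq.
  move=> i lin; have [sub nsub] := qS i lin; split=> [r /sub //|sub'].
  apply: nsub; have [pqi _] := qP i (ltnW lin); have [pqi1 _] := qP i.+1 lin.
  apply: incomparable => //; exact: prime_ideal_ideal.
suff [P [PP PS]] : exists P : nat -> set S,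
    (forall i, (i <= n)%N ->
      [/\ prime_ideal (P i), J `<=` P i & contraction phi (P i) = q i]) /\
    (forall i, (i < n)%N -> P i `<=` P i.+1).
  exists P => [i /PP[] //|i lin]; split; first exact: PS.
  have [_ nsub] := qS i lin.
  have [_ _ Ei] := PP i (ltnW lin); have [_ _ Ei1] := PP i.+1 lin.
  by move=> sub'; apply: nsub; rewrite -Ei -Ei1 => r; exact: sub'.
elim: n qP qS => [|n IHn] qP qS.
  have [pq0 Jq0] := qP 0%N isT; have [P [pP JP PE]] := going_up idJ pq0 Jq0.
  by exists (fun=> P); split=> // i; rewrite leqn0 => /eqP->.
have [i lin|i lin|P [PP PS]] := IHn.
- by apply: qP; exact: leqW.
- by apply: qS; exact: leqW.
have [pPn JPn En] := PP n (leqnn n).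
have [pq _] := qP n.+1 (leqnn _).
have [|P' [pP' PP' E']] := going_up (prime_ideal_ideal pPn) pq.
  by rewrite En; have [] := qS n (leqnn _).
exists (fun i => if (i <= n)%N then P i else P'); split=> i.
  case: ifP => [le_in _|]; first exact: PP.
  move=> /negbT; rewrite -ltnNge => lt_ni le_in1.
  have -> : i = n.+1 by apply/eqP; rewrite eqn_leq le_in1.
  by split=> //; exact: subset_trans PP'.
rewrite ltnS => le_in; rewrite le_in; case: ifP => [lin|]; first exact: PS.
move=> /negbT; rewrite -leqNgt => le_ni.
by have -> : i = n by apply/eqP; rewrite eqn_leq le_in.
Qed.

Lemma krull_dim_contraction J : ideal J ->
  krull_dim (quot_ring (contraction phi J)) = krull_dim (quot_ring J).
Proof.
move=> idJ; rewrite !krull_dim_quot_ring //; last exact: ideal_contraction.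
by rewrite chain_lengths_contraction.
Qed.


End FiniteExtension.

(** * Restriction of scalars *)

Section RestrictedModules.
Variables (R S : comNzRingType) (phi : {rmorphism R -> S}).

Section Multiplication.
Variables (B : lmodType S) (s : S).

Definition restr_mul (x : restr phi B) : restr phi B := s *: (x : B).

Fact restr_mul_linear : linear restr_mul.
Proof.
move=> r x y; rewrite /restr_mul.
rewrite -[r *: x + y]/((phi r *: (x : B) + (y : B)) : B) scalerDr.
by rewrite scalerA mulrC -scalerA.
Qed.

HB.instance Definition _ := GRing.isLinear.Build R (restr phi B) (restr phi B)
  *:%R restr_mul restr_mul_linear.

End Multiplication.

Lemma restr_artinianW (B : lmodType S) : artinian (restr phi B) -> artinian B.
Proof. by move=> art N sN; apply: art => i; exact: submodule_restr. Qed.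

Lemma coprimary_restr (B : lmodType S) P (K : set B) : coprimary P K ->
  coprimary (contraction phi P) (K : set (restr phi B)).
Proof.
move=> [pP sK KT divK nilK]; split=> //.
- exact: prime_contraction.
- exact: submodule_restr.
- by move=> r nPr x; exact: divK.
- move=> r /nilK[k rk]; exists k => x.
  by have := rk x; rewrite -rmorphXn.
Qed.

Lemma ann_restr (B : lmodType S) :
  ann (restr phi B) = contraction phi (ann B).
Proof. by []. Qed.

Hypothesis finS : fin_gen [set: restr phi S^o].

Lemma mdim_restr (B : lmodType S) : mdim (restr phi B) = mdim B.
Proof.
by rewrite /mdim ann_restr krull_dim_contraction //; exact: ideal_ann.
Qed.

(** Minimality over the extended ideal gives the associated prime. The dimensions agree because [P]
    and the extended ideal have the same contraction. *)
Lemma Assh_over P : noetherian S -> prime_ideal P ->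
  Assh (quot_mod (ideal_ext phi (contraction phi P) : set S^o)) P.
Proof.
move=> noeth pP; set J := ideal_ext _ _.
have idJ : ideal J by exact: ideal_ideal_ext.
have JP : J `<=` P.
  by apply: ideal_ext_sub => //; exact: prime_ideal_ideal.
have JE : contraction phi J = contraction phi P.
  apply/seteqP; split=> r; first exact: JP.
  by move=> Pr; exact: ideal_ext_mem.
apply/AsshE => //; split=> //.
  apply: minimal_prime_colon => // Q pQ JQ QP.
  apply: (incomparable finS) => //; first exact: prime_ideal_ideal.
  by rewrite -JE => r; exact: JQ.
rewrite -(krull_dim_contraction finS idJ) JE krull_dim_contraction //.
exact: prime_ideal_ideal.
Qed.

Lemma Att_restr (B : lmodType S) P : artinian (restr phi B) -> Att B P ->
  Att (restr phi B) (contraction phi P).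
Proof.
move=> art /Att_coprimary[K cK]; apply/AttP => //.
by exists K; exact: coprimary_restr.
Qed.

Section Local.
Variables (m : set R) (n : set S).
Hypotheses (locR : is_local m) (locS : is_local n).

Lemma contraction_sub_local J : ideal J -> ~ J 1 -> contraction phi J `<=` m.
Proof.
move=> idJ J1; apply: local_max => //; first exact: ideal_contraction.
by rewrite /contraction /preimage /= rmorph1.
Qed.

Lemma contraction_local : contraction phi n = m.
Proof.
have pn := local_prime locS.
apply/seteqP; split.
  by apply: contraction_sub_local; [exact: prime_ideal_ideal|exact: prime1].
have id0 : ideal [set 0 : S] by exact: (@submodule_set0 S S^o).
have [|P [pP _ <-] r Pr] := going_up finS id0 (local_prime locR).
  apply: contraction_sub_local => //= /eqP; by rewrite oner_eq0.
by apply: (local_max locS _ _ Pr); [exact: prime_ideal_ideal|exact: prime1].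
Qed.

(** Otherwise a prime containing the extension of [m] would avoid the powers of [y]; but
    incomparability makes [n] the only prime above that extension. *)
Lemma local_nilpotent_ext y : n y -> exists k, ideal_ext phi m (y ^+ k).
Proof.
move=> ny; apply: contrapT => /forallNP h.
have idE : ideal (ideal_ext phi m) by exact: ideal_ideal_ext.
have [x Ex [k _ kx]|||Q [pQ EQ Qy]] :=
    @prime_avoiding S (ideal_ext phi m) [set y ^+ k | k in [set: nat]] idE.
- by apply: (h k); rewrite kx.
- by exists 0%N; rewrite ?expr0.
- by move=> _ _ [k _ <-] [l _ <-]; exists (k + l)%N; rewrite ?exprD.
have idQ := prime_ideal_ideal pQ.
have Qn : Q `<=` n by apply: local_max => //; exact: prime1.
have nQ : n `<=` Q.
  apply: (incomparable finS pQ) => //; first exact: prime_ideal_ideal (local_prime locS).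
  by rewrite contraction_local => r mr; apply: EQ; exact: ideal_ext_mem.
by apply: (Qy y (nQ _ ny)); exists 1%N; rewrite ?expr1.
Qed.

(* A minimal [S]-submodule violating the chain condition over [R] is killed by
   [n]; splitting off one element then contradicts its minimality. *)
Lemma restr_artinian (B : lmodType S) : artinian B -> artinian (restr phi B).
Proof.
move=> art; apply/artinian_dcc; apply: contrapT => nT.
pose F := [set M : set B | submodule M /\ ~ dcc (M : set (restr phi B))].
have [||M [sM nM] Mmin] := @dcc_min _ _ F art.
- by exists setT; split=> //; exact: submodule_setT.
- by move=> N [].
have proper N : submodule N -> N `<=` M -> dcc (N : set (restr phi B)) \/ N = M.
  move=> sN NM; have [|nN] := pselect (dcc (N : set (restr phi B))); [by left|right].
  exact: Mmin.
have sMR : submodule (M : set (restr phi B)) by exact: submodule_restr.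
have M0 : exists2 b, M b & b <> 0.
  apply: contrapT => h; apply: nM; apply: (@dcc_sub _ _ _ [set 0]); last exact: dcc_set0.
  by move=> b Mb; apply: contrapT => b0; apply: h; exists b.
(* Kernel and image of [s] on [M] are [S]-submodules; if both were proper, both would satisfy the
   chain condition over [R], and so would [M]. *)
have dich s : (forall v, M v -> s *: v = 0) \/
    (forall v, M v -> exists2 u, M u & v = s *: u).
  have sI : submodule [set s *: v | v in M].
    apply: submodule_intro => [|_ _ [x Mx <-] [y My <-]|a _ [x Mx <-]].
    - by exists 0; [exact: submodule0|rewrite scaler0].
    - by exists (x + y); [exact: submoduleD|rewrite scalerDr].
    - by exists (a *: x); [exact: submoduleZ|rewrite !scalerA mulrC].
  have [|dK|KE] := proper _ (submodule_ann_in s sM); first by move=> v [].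
    have [|dI|IE] := proper _ sI; first by move=> _ [v Mv <-]; exact: submoduleZ.
      by case: nM; exact: (@dcc_ext _ _ _ (restr_mul s) M sMR dK dI).
    by right=> v; rewrite -{1}IE => -[u Mu <-]; exists u.
  by left=> v; rewrite -{1}KE => -[].
(* [phi x] is locally nilpotent on [B], so a proper kernel on [M] would give [M] the chain condition
   by [dcc_torsion]. *)
have mM x : m x -> forall v, M v -> phi x *: v = 0.
  move=> mx.
  have [|dK|KE] := proper _ (submodule_ann_in (phi x) sM); first by move=> v [].
    case: nM; apply: (@dcc_torsion _ (restr phi B) _ x) => // v _.
    have nx : n (phi x) by rewrite -[n _]/(contraction phi n x) contraction_local.
    have [k xk] := artinian_torsion art locS nx v; exists k.
    by rewrite -rmorphXn in xk.
  by move=> v; rewrite -{1}KE => -[].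
have extM s : ideal_ext phi m s -> forall v, M v -> s *: v = 0.
  pose Y := [set s : S | forall v, M v -> s *: v = 0].
  suff : ideal_ext phi m `<=` Y by apply.
  apply: ideal_ext_sub => [|x mx]; last exact: mM.
  apply: ideal_intro => [v _|a b Ya Yb v Mv|a b Yb v Mv].
  - exact: scale0r.
  - by rewrite scalerDl Ya // Yb // addr0.
  - by rewrite -scalerA Yb // scaler0.
(* If [y] were surjective on [M], so would be all its powers, yet one of them lies in the extension
   of [m], which kills [M]. *)
have nM0 y : n y -> forall v, M v -> y *: v = 0.
  move=> ny; have [//|surj] := dich y; have [k Eyk] := local_nilpotent_ext ny.
  have powsurj : forall j v, M v -> exists2 u, M u & v = y ^+ j *: u.
    elim=> [|j IHj] v Mv; first by exists v; rewrite ?expr0 ?scale1r.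
    have [u Mu ->] := IHj _ Mv; have [w Mw ->] := surj _ Mu.
    by exists w; rewrite // exprSr scalerA.
  by move=> v /(powsurj k)[u Mu ->]; rewrite (extM _ Eyk) // scaler0.
have [b Mb b0] := M0.
(* The clause [~ M x] confines the maximal submodule avoiding [b] to [M]. *)
have [|N [sN _ ND Nmax]] :=
    @max_avoiding S B [set 0] [set x | x = b \/ ~ M x] (@submodule_set0 _ _).
  by move=> _ -> [/esym//|]; apply; exact: submodule0.
have NM : N `<=` M.
  by move=> x Nx; apply: contrapT => nMx; apply: (ND x Nx); right.
have [dN|NE] := proper _ sN NM; last first.
  by apply: (ND b); [rewrite NE|left].
(* If [N + S x] contains [b], the coefficient of [x] is a unit because [n] kills [M]; if it does
   not, maximality puts [x] in [N]. *)
have MNb : M `<=` submod_add N (line b).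
  move=> x Mx; apply: contrapT => nx.
  have sK := submodule_add sN (submodule_line x).
  have KM : submod_add N (line x) `<=` M.
    by apply: submod_add_min => //; exact: line_min.
  have [Kb|nKb] := pselect (submod_add N (line x) b).
    have [y [_ [Ny [s _ <-] bE]]] := Kb.
    have ns : ~ n s.
      by move=> /nM0 s0; apply: (ND b); [rewrite bE s0 // addr0|left].
    have [u us] := local_unit locS ns.
    apply: nx; exists (- (u *: y)), (u *: b); split.
    + by apply: submoduleN => //; exact: submoduleZ.
    + by exists u.
    + by rewrite bE scalerDr scalerA us scale1r addKr.
  apply: nx; apply: submod_addl; first exact: submodule_line.
  apply: (Nmax (submod_add N (line x))) => //.
  - by apply: submod_addl; exact: submodule_line.
  - by move=> z Kz [zb|]; [apply: nKb; rewrite -zb|apply; exact: KM].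
  - by apply: submod_addr => //; exact: line_mem.
have [s sT] := restr_lincomb finS.
pose sb := [seq ((t : S) *: b : restr phi B) | t <- s].
have lineE : line b `<=` lincomb setT sb.
  move=> _ [t _ <-]; have := sT t; rewrite /sb; elim: (s) t => [|u s' IHs] t /=.
    by move=> ->; rewrite scale0r.
  move=> [a [y [_ s'y ->]]]; exists a, ((y : S) *: b); split=> //; first exact: IHs.
  have dist : (phi a * (u : S) + (y : S)) *: b =
      phi a *: ((u : S) *: b) + (y : S) *: b by rewrite scalerDl scalerA.
  exact: dist.
(* [N] satisfies the chain condition by minimality of [M], and [S b] is spanned over [R] by finitely
   many vectors killed by [m]. *)
apply: nM; apply: (@dcc_sub _ (restr phi B) _ (submod_add N (lincomb setT sb))).
  move=> x /MNb[y [z [Ny bz ->]]]; exists y, z; split=> //; exact: lineE.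
apply: dcc_add => //.
- exact: submodule_restr.
- by apply: submodule_lincomb; exact: (@submodule_setT R R^o).
- apply: (dcc_lincomb locR) => _ /mapP[t _ ->] x mx.
  rewrite -[LHS]/(phi x *: ((t : S) *: b)) scalerA mulrC -scalerA.
  by rewrite mM // scaler0.
Qed.

End Local.
End RestrictedModules.

(** * Base change *)

(** [K] is enlarged by [c V] for each generator [c] of [p]. It stays proper, since [K + c V = V]
    iterates to [K + c ^+ k V = V] while some [c ^+ k V] lies in [K]. *)
Lemma coprimary_kill (R : comNzRingType) (V : lmodType R) (p : set R) (K : set V) :
  noetherian R -> coprimary p K ->
  exists K', coprimary p K' /\ forall r, p r -> forall x : V, K' (r *: x).
Proof.
move=> noeth cK; have pp : prime_ideal p by case: cK.
have [s ps] := noeth p (prime_ideal_ideal pp).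
have sp : [set` s] `<=` p by rewrite ps; exact: (@sub_span R R^o).
suff [K' [cK' sK']] : exists K', coprimary p K' /\
    forall r, r \in s -> forall x : V, K' (r *: x).
  exists K'; split=> // r; have [_ subK' _ _ _] := cK'.
  pose Y := [set r | forall x : V, K' (r *: x)].
  suff : p `<=` Y by apply.
  rewrite ps; apply: (@span_min R R^o); last exact: sK'.
  apply: ideal_intro => [x|a b Ya Yb x|a b Yb x].
  - by rewrite scale0r; exact: submodule0.
  - by rewrite scalerDl; exact: submoduleD.
  - by rewrite -scalerA; exact: submoduleZ.
elim: {ps} s sp => [|c s IHs] sp; first by exists K.
have [|K' [[_ subK' K'T divK' nilK'] sK']] := IHs.
  by move=> x xs; apply: sp; rewrite /= inE xs orbT.
have pc : p c by apply: sp; rewrite /= mem_head.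
have scV : submodule [set c *: x | x in [set: V]].
  apply: submodule_intro => [|_ _ [x _ <-] [y _ <-]|a _ [x _ <-]].
  - by exists 0; rewrite ?scaler0.
  - by exists (x + y); rewrite ?scalerDr.
  - by exists (a *: x); rewrite ?scalerA 1?mulrC.
exists (submod_add K' [set c *: x | x in [set: V]]); split; last first.
  move=> r; rewrite inE => /orP[/eqP->|rs] x.
    by apply: submod_addr => //; exists x.
  by apply: submod_addl => //; exact: sK'.
split=> //.
- exact: submodule_add.
- move=> KcT; apply: K'T; apply/seteqP; split=> // x _.
  have iter k : forall x : V, exists y, K' (x - c ^+ k *: y).
    elim: k => [|k IHk] v; first by exists v; rewrite expr0 scale1r subrr; exact: submodule0.
    have [y Kvy] := IHk v; have : [set: V] y by [].
    rewrite -KcT => -[u [_ [Ku [z _ <-] yE]]]; exists z.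
    have -> : v - c ^+ k.+1 *: z = (v - c ^+ k *: y) + c ^+ k *: u.
      by rewrite yE scalerDr scalerA -exprSr opprD [- _ - _]addrC addrA subrK.
    by apply: submoduleD => //; exact: submoduleZ.
  have [k ck] := nilK' _ pc; have [y Kxy] := iter k x.
  by rewrite -(subrK (c ^+ k *: y) x); exact: submoduleD.
- move=> r npr x; have [y Kxy] := divK' _ npr x; exists y; exact: submod_addl.
- move=> r pr; have [k rk] := nilK' _ pr; exists k => x; exact: submod_addl.
Qed.

Section BaseChangeTheory.
Variables (R S : comNzRingType) (phi : {rmorphism R -> S}) (A : lmodType R).
Let M : lmodType R := restr phi S^o.
Let T : lmodType R := tensor A M.

Section Slice.
Variable t : M.
Definition tens_slice (a : A) : T := tens a t.
HB.instance Definition _ := GRing.isLinear.Build R A T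
  *:%R tens_slice (tens_linearl t).
End Slice.

Section SliceAt.
Variable a : A.
Definition tens_at (t : M) : T := tens a t.
HB.instance Definition _ := GRing.isLinear.Build R M T
  *:%R tens_at (tens_linearr a).
End SliceAt.

Lemma tensZl c a (t : M) : tens (c *: a) t = c *: (tens a t : T).
Proof. exact: (linearZ_LR (tens_slice t) c a). Qed.

Lemma tensZr c a (t : M) : tens a (c *: t) = c *: (tens a t : T).
Proof. exact: (linearZ_LR (tens_at a) c t). Qed.

(** This lets [S]-submodules of the base change be handled as [R]-submodules of the tensor
    product. *)
Lemma base_change_restr r (x : T) :
  phi r *: (x : base_change phi A) = r *: x.
Proof.
elim/(@tensor_ind R A M): x => [|c a t x IHx].
  transitivity (0 : T); last by rewrite scaler0.
  exact: (@scaler0 S (base_change phi A) (phi r)).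
have -> : c *: tens a t = tens (c *: a) t by rewrite tensZl.
transitivity (phi r *: (tens (c *: a) t : base_change phi A) +
              phi r *: (x : base_change phi A) : T).
  exact: (@scalerDr S (base_change phi A)).
rewrite IHx scalerDr; congr (_ + _).
rewrite -[LHS]/(base_change_scale (phi r) (tens (c *: a) t)) base_change_scaleE.
exact: tensZr.
Qed.

Hypothesis finS : fin_gen [set: restr phi S^o].

(** The tensor product is the finite sum of the images of [A] under tensoring with the generators of
    [S], so even its [R]-submodules satisfy the chain condition. *)
Lemma base_change_artinian : artinian A -> artinian (base_change phi A).
Proof.
move=> /artinian_dcc artA; have [s sT] := restr_lincomb finS.
pose fix U (s : seq M) : set T :=
  if s is t :: s' then submod_add (tens_slice t @` setT) (U s') else [set 0].
have sU s' : submodule (U s').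
  elim: s' => [|t s' IHs]; first exact: submodule_set0.
  by apply: submodule_add => //; apply: submodule_image; exact: submodule_setT.
have dU s' : dcc (U s').
  elim: s' => [|t s' IHs]; first exact: dcc_set0.
  apply: dcc_add => //; first by apply: submodule_image; exact: submodule_setT.
  by apply: dcc_image => //; exact: submodule_setT.
have memU s' a t : lincomb setT s' t -> U s' (tens a t).
  elim: s' t => [|u s' IHs] t /=.
    by move=> ->; exact: (raddf0 (tens_at a)).
  move=> [c [y [_ s'y ->]]]; exists (tens (c *: a) u), (tens a (y : M)); split.
  - by exists (c *: a).
  - exact: IHs.
  - rewrite [LHS](linearP (tens_at a) c u y); congr (_ + _).
    by rewrite tensZl.
have UT (x : T) : U s x.
  elim/(@tensor_ind R A M): x => [|c a t x Ux].
    exact: (submodule0 (sU s)).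
  apply: (submoduleD (sU s)) => //; apply: (submoduleZ _ (sU s)); apply: memU; exact: sT.
move=> N sN Nd; apply: (dU s) => // [i|i x _]; last exact: UT.
have sNi := sN i; apply: submodule_intro.
- exact: (submodule0 sNi).
- by move=> x y; exact: (submoduleD sNi).
- by move=> r x Nx; rewrite -base_change_restr; exact: (submoduleZ (phi r) sNi).
Qed.

Lemma ann_sub_base_change : ann A `<=` ann (restr phi (base_change phi A)).
Proof.
move=> r rA x; apply: etrans (base_change_restr r x) _.
have rA' : forall a : A, r *: a = 0 by [].
suff : r *: (x : T) = 0 by [].
elim/(@tensor_ind R A M): x => [|c a t x IHx]; first by rewrite scaler0.
rewrite scalerDr scalerA mulrC -scalerA IHx addr0 -tensZl rA'.
by rewrite [tens _ _](raddf0 (tens_slice t)) scaler0.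
Qed.

(* [S / N] is torsion-free of rank one over [R / p], and [h] is its embedding in
   [R / p] after scaling by the common denominator [q]. *)
Lemma rank_one_quotient p : injective phi -> prime_ideal p ->
  exists (h : M -> R) (q : R) (N : set M),
  [/\ submodule N, forall r, N (phi r : S) -> p r,
      forall r (y : M), p r -> N (r *: y), ~ p q &
      forall y : M, N (q *: y - (phi (h y) : S))].
Proof.
move=> phi_inj pp.
have [P pP PE] := lying_over finS phi_inj pp.
have idP := prime_ideal_ideal pP.
have PM : submodule (P : set M) by exact: (@submodule_restr R S phi S^o).
have pP_ r : p r <-> P (phi r) by rewrite -PE.
have [|N [sN PN ND Nmax]] := @max_avoiding R M P [set phi r | r in ~` p] PM.
  by move=> x Px [r npr rx]; apply: npr; apply/pP_; rewrite rx.
have Np r : N (phi r : S) -> p r.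
  by move=> Nr; apply: contrapT => npr; apply: (ND _ Nr); exists r.
have pN r (y : M) : p r -> N (r *: y).
  by move=> /pP_ Pr; apply: PN; exact: (ideal_mulr _ idP Pr).
(* For [y] outside [N], maximality puts some [phi w] with [w] outside [p] into [N + R y]; were the
   coefficient of [y] in [p], [phi w] would lie in [N]. *)
have key (y : M) : exists q r, ~ p q /\ N (q *: y - (phi r : S)).
  have [Ny|nNy] := pselect (N y).
    exists 1, 0; split; first exact: prime1.
    by rewrite scale1r rmorph0 subr0.
  have [|h] := pselect (exists2 x, submod_add N (line y) x & [set phi r | r in ~` p] x).
    move=> [_ [n [_ [Nn [a _ <-] ->]]] [w npw wE]]; exists a, w; split.
      move=> /(pN _ y) Nay; apply: npw; apply: Np; rewrite wE.
      exact: (submoduleD sN).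
    rewrite wE opprD addrCA subrr addr0; exact: submoduleN.
  exfalso; apply: nNy; apply: (Nmax (submod_add N (line y))).
  - by apply: submodule_add => //; exact: submodule_line.
  - by apply: submod_addl; exact: submodule_line.
  - by move=> x Nx Dx; apply: h; exists x.
  - by apply: submod_addr => //; exact: line_mem.
have [s sT] := restr_lincomb finS.
have [q npq qP] : exists2 q, ~ p q &
    forall y, lincomb setT s y -> exists r, N (q *: y - (phi r : S)).
  elim: (s) => [|t s' [q npq IHs]].
    exists 1; first exact: prime1.
    move=> y ->; exists 0; rewrite scaler0 rmorph0 subr0; exact: submodule0.
  have [q' [r' [npq' Nt]]] := key t.
  exists (q * q'); first exact: primeM.
  move=> _ [a [y [_ /IHs[r Nr] ->]]]; exists (q * a * r' + q' * r).
  have -> : (q * q') *: (a *: t + y) - (phi (q * a * r' + q' * r) : S) =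
     (q * a) *: (q' *: t - (phi r' : S)) + q' *: (q *: y - (phi r : S)) :> M.
    have e (b c : R) : b *: (phi c : M) = phi (b * c) by rewrite rmorphM.
    rewrite !scalerBr !scalerA scalerDr !scalerA !e rmorphD /=.
    rewrite (mulrAC q q' a) (mulrC q' q) opprD addrACA; congr (_ + _).
  by apply: submoduleD => //; exact: submoduleZ.
have [h hP] := choice (fun y => qP y (sT y)).
by exists h, q, N; split.
Qed.

(** The pairing sends [(a, y)] to [h y *: a] in [A / K]; [h] is linear only modulo [p], so [K] is
    first enlarged until [p] kills the quotient. On [y = 1] the factor [h 1] is outside [p], so an
    annihilating [r0] outside [p] would make [h 1 * r0] both zero and surjective on [A / K]. *)
Lemma ann_base_change_sub p : noetherian R -> injective phi -> Att A p ->
  ann (restr phi (base_change phi A)) `<=` p.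
Proof.
move=> noeth phi_inj /Att_coprimary[K0 /(coprimary_kill noeth)[K [cK pK]]].
have [pp sK KT divK nilK] := cK; have idp := prime_ideal_ideal pp.
have [h [q [N [sN Np pN npq hP]]]] := rank_one_quotient phi_inj pp.
pose f (a : A) (y : M) : quot_mod K := quot_pi K (h y *: a).
have flinl y : linear (f^~ y).
  move=> r a b; rewrite /f -linearP; congr (quot_pi K _).
  by rewrite scalerDr !scalerA mulrC.
have flinr a : linear (f a).
  move=> r y z; rewrite /f -linearP; apply/quot_piP; rewrite span_id //.
  rewrite scalerA -scalerDl -scalerBl; apply: pK; apply: Np.
  have -> : (phi (h (r *: y + z) - (r * h y + h z)) : S) =
     r *: (q *: y - (phi (h y) : S)) + (q *: z - (phi (h z) : S)) -
     (q *: (r *: y + z) - (phi (h (r *: y + z)) : S)) :> M.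
    set H := h (r *: y + z); change (phi (H - (r * h y + h z)) =
      phi r * (phi q * (y : S) - phi (h y)) + (phi q * (z : S) - phi (h z)) -
      (phi q * (phi r * (y : S) + (z : S)) - phi H)).
    by rewrite rmorphB rmorphD rmorphM; ring.
  apply: submoduleB => //; apply: submoduleD => //; exact: submoduleZ.
move=> r0 r0ann; apply: contrapT => npr0.
have nph1 : ~ p (h (1 : S)).
  move=> ph1; apply: npq; apply: Np; have := hP (1 : S); set y : M := phi (h _).
  have Ny : N y.
    have := pN _ (1 : S) ph1; rewrite -[_ *: _]/(phi (h (1 : S)) * 1 : S).
    by rewrite mulr1.
  move=> Nqy; have : N (q *: ((1 : S) : M)).
    by rewrite -[X in N X](subrK y); exact: submoduleD.
  by rewrite -[q *: _]/(phi q * 1 : S) mulr1.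
pose e1 : M := (1 : S).
have kill a : K ((h e1 * r0) *: a).
  have : r0 *: f a e1 = 0.
    rewrite -(tensor_liftE flinl flinr).
    have := r0ann (tens a e1); rewrite [_ *: _]base_change_restr => e.
    have lin := tensor_lift_linear flinl flinr.
    have lift0 : tensor_lift f 0 = 0.
      by have := lin (-1) 0 0; rewrite scaler0 addr0 scaleN1r addNr.
    by have := lin r0 (tens a e1) 0; rewrite e !addr0 lift0 addr0 => <-.
  rewrite /f -linearZ -(raddf0 (quot_pi K)) => /quot_piP.
  by rewrite span_id // subr0 scalerA mulrC.
apply: KT; apply/seteqP; split=> // x _.
have [y Ky] := divK _ (primeM pp nph1 npr0) x.
by rewrite -(subrK ((h e1 * r0) *: y) x); exact: submoduleD.
Qed.

End BaseChangeTheory.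

Section AttBaseChange.
Variables (R S : comNzRingType) (phi : {rmorphism R -> S}) (A : lmodType R).

Lemma Att_base_change P : artinian A -> Att (base_change phi A) P ->
  Att A (contraction phi P).
Proof.
move=> art /Att_coprimary[K /(coprimary_restr phi)cK].
have [n [q [N NA]]] := artinian_min_secondary_repr art.
have [sN NT _ _] := NA.
suff [i ->] : exists i, contraction phi P = q i.
  by exists n, q, N; split=> //; exists i.
pose B : lmodType R := restr phi (base_change phi A).
have scale r a (t : restr phi S^o) : r *: (tens a t : B) = tens (r *: a) t.
  by rewrite [LHS]base_change_restr tensZl.
pose L i : set B := [set x | exists a t, N i a /\ x = tens a t].
apply: (@coprimary_cover R B n q L) cK.
- by move=> i; case: (sN i).
- move=> i r nqr _ [a [t [Na ->]]].
  have [b Nb ->] := secondary_divisible (sN i) nqr Na.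
  by exists (tens b t); [exists b, t|rewrite scale].
- move=> i r qr; have [_ _ _ nil] := sN i; have [k rk] := nil _ qr.
  exists k => _ [a [t [Na ->]]]; rewrite scale rk //.
  exact: (raddf0 (tens_slice (t : restr phi S^o))).
- move=> K' sK' LK'; apply/seteqP; split=> // x _.
  elim/(@tensor_ind R A (restr phi S^o)): x => [|c a t x Kx].
    exact: (submodule0 sK').
  apply: (@submoduleD R B) => //.
  rewrite -tensZl; have : [set: A] (c *: a) by [].
  rewrite -NT => -[f fN ->].
  rewrite [tens _ _](raddf_sum (tens_slice (t : restr phi S^o))).
  apply: (@submodule_sum R B) => // i _; apply: (LK' i).
  by exists (f i), t; split=> //; exact: fN.
Qed.

(** The two annihilators lie in the same primes of [R]: a prime above that of [A] contains an
    attached prime, which contains that of the base change. *)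
Lemma mdim_base_change : fin_gen [set: restr phi S^o] -> noetherian R ->
  injective phi -> artinian A -> mdim (base_change phi A) = mdim A.
Proof.
move=> finS noeth phi_inj art; rewrite -(mdim_restr finS) /mdim.
rewrite !krull_dim_quot_ring; try exact: ideal_ann.
congr (supremum _ [set _ | n in _]).
have E Q : prime_ideal Q ->
    ann (restr phi (base_change phi A)) `<=` Q <-> ann A `<=` Q.
  move=> pQ; split=> sub; first exact: subset_trans (@ann_sub_base_change _ _ _ _) sub.
  have [p Ap pQ'] := prime_over_ann art pQ sub.
  apply: subset_trans pQ'; exact: ann_base_change_sub.
by apply/seteqP; split=> n [p pP pS]; exists p => // i /pP[pp ap];
  split=> //; exact/E.
Qed.

End AttBaseChange.

(** * Finiteness of the dimension *)

Section FiniteDimension.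
Variable R : comNzRingType.
Implicit Types (I J P Q p : set R).

Lemma proper_ex T (X Y : set T) : X `<` Y -> exists2 x, Y x & ~ X x.
Proof. by case=> _ /existsNP[x /not_implyP[Yx nXx]]; exists x. Qed.

Lemma add_lineP (M : set R) g a :
  submod_add (M : set R^o) (line (g : R^o)) a <->
  exists b r, M b /\ a = b + r * g.
Proof.
split=> [[b [_ [Mb [r _ <-] ->]]]|[b [r [Mb ->]]]]; first by exists b, r.
by exists b, (r * g); split=> //; exists r.
Qed.

(* [R / J] localised at a minimal prime [P] of [J] is Artinian. *)
Lemma dcc_minimal_prime J P (I : nat -> set R) : noetherian R -> ideal J ->
  prime_ideal P -> J `<=` P ->
  (forall Q, prime_ideal Q -> J `<=` Q -> Q `<=` P -> P `<=` Q) ->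
  (forall i, ideal (I i)) -> (forall i, I i.+1 `<=` I i) ->
  (forall i, J `<=` I i) ->
  exists n, forall k, (n <= k)%N -> forall a, I n a -> exists2 w, ~ P w & I k (w * a).
Proof.
move=> noeth idJ pP JP Pmin idI Id JI; have idP := prime_ideal_ideal pP.
(* Ideals on whose traces the chain stabilises locally at [P]. A member of [F] not inside [P]
   settles the claim, since one of its elements serves as a denominator. *)
pose F := [set M | [/\ ideal M, J `<=` M & exists n, forall k, (n <= k)%N ->
  forall a, I n a -> M a -> exists2 w, ~ P w & I k (w * a)]].
have [||M [idM JM [n0 nM]] Mmax] := @noetherian_max _ F noeth.
- exists J; split=> //; exists 0%N => k _ a _ Ja.
  by exists 1; [exact: prime1|rewrite mul1r; exact: JI].
- by move=> M [].
have [MP|nMP] := pselect (M `<=` P); last first.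
  have [w /not_implyP[Mw nPw]] : exists w, ~ (M w -> P w) by exact/existsNP.
  exists n0 => k nk a Ia.
  have [||w' nPw' Iw] := nM k nk (w * a).
  - exact: idealM.
  - exact: ideal_mulr.
  - by exists (w' * w); [exact: primeM|rewrite -mulrA].
exfalso.
have [Q pQ MQ QP|g PE] := minimal_prime_colon noeth idM pP MP.
  by apply: Pmin => //; exact: subset_trans MQ.
have idg : ideal (submod_add (M : set R^o) (line (g : R^o))).
  by apply: submodule_add => //; exact: submodule_line.
have Pg r : P r -> M (r * g) by rewrite PE.
suff : submod_add (M : set R^o) (line (g : R^o)) `<=` M.
  move=> sub; apply: (prime1 pP); rewrite PE /colon /= mul1r; apply: sub.
  by apply: (@submod_addr R R^o) => //; exact: (@line_mem R R^o).
apply: Mmax; last by apply: (@submod_addl R R^o); exact: submodule_line.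
split=> //.
  apply: subset_trans JM _; apply: (@submod_addl R R^o); exact: submodule_line.
have descI i j : (i <= j)%N -> I j `<=` I i by exact: descending_sub.
(* Locally at [P], [M + (g)] over [M] is a simple layer. Either every [I i] contains [g] modulo [M],
   up to a factor outside [P], or from [i0] on the trace of the chain on [M + (g)] lies in [M]. *)
have [h|/existsNP[i0 h]] := pselect (forall i, exists r mm,
    [/\ ~ P r, M mm & I i (r * g + mm)]).
  exists n0 => k nk a Ia /add_lineP[mm [r [Mm aE]]].
  have [r' [m' [nPr' Mm' Ib]]] := h k.
  have [||w nPw Iw] := nM k nk (r' * a - r * (r' * g + m')).
  - apply: idealB => //; apply: idealM => //; exact: descI Ib.
  - have -> : r' * a - r * (r' * g + m') = r' * mm - r * m'.
      by rewrite aE; ring.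
    by apply: idealB => //; exact: idealM.
  exists (w * r'); first exact: primeM.
  have -> : w * r' * a = w * (r' * a - r * (r' * g + m')) + w * r * (r' * g + m').
    by ring.
  by apply: idealD => //; exact: idealM.
exists (maxn n0 i0) => k nk a Ia /add_lineP[mm [r [Mm aE]]].
have Ma : M a.
  have Pr : P r.
    apply: contrapT => nPr; apply: h; exists r, mm; split=> //.
    apply: (descI _ _ (leq_maxr n0 i0)); move: Ia; by rewrite aE addrC.
  rewrite aE; apply: (@idealD _ M) => //; exact: Pg.
apply: nM => //; first by apply: leq_trans nk; exact: leq_maxl.
exact: descI (leq_maxl n0 i0) _ Ia.
Qed.

(* Krull's principal ideal theorem, with the symbolic powers of [Q] replaced by
   the [Q]-saturations of the powers of an element of [Q \ P0]. *)
Lemma principal_ideal_theorem P0 Q P x : noetherian R ->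
  prime_ideal P0 -> prime_ideal Q -> prime_ideal P ->
  P0 `<` Q -> Q `<` P -> P x ->
  exists P', [/\ prime_ideal P', P0 `<=` P', P' x & P' `<` P].
Proof.
move=> noeth pP0 pQ pP P0Q QP Px; apply: contrapT => nP'.
have [idP0 idQ idP] : [/\ ideal P0, ideal Q & ideal P].
  by split; exact: prime_ideal_ideal.
have [sP0Q sQP] : P0 `<=` Q /\ Q `<=` P by split; [case: P0Q|case: QP].
pose J := submod_add (P0 : set R^o) (line (x : R^o)).
have idJ : ideal J by apply: submodule_add => //; exact: submodule_line.
have P0J : P0 `<=` J by apply: (@submod_addl R R^o); exact: submodule_line.
have Jx : J x by apply: (@submod_addr R R^o) => //; exact: (@line_mem R R^o).
have JP : J `<=` P.
  apply: (@submod_add_min R R^o) => //; first exact: subset_trans sQP.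
  exact: (@line_min R R^o).
have Pmin Q' : prime_ideal Q' -> J `<=` Q' -> Q' `<=` P -> P `<=` Q'.
  move=> pQ' JQ' Q'P; apply: contrapT => nPQ'; apply: nP'.
  by exists Q'; split=> //; [exact: subset_trans JQ'|exact: JQ'].
have nQx : ~ Q x.
  by move=> Qx; apply: nP'; exists Q; split.
have [y Qy nP0y] := proper_ex P0Q.
(* The [Q]-saturation of the ideal generated by [P0] and [y ^+ n]. *)
pose I n := [set a : R | exists s b z : R, [/\ ~ Q s, P0 z & s * a = b * y ^+ n + z]].
have idI n : ideal (I n).
  apply: ideal_intro.
  - exists 1, 0, 0; split; [exact: prime1|exact: ideal0|by rewrite mulr0 mul0r addr0].
  - move=> a a' [s [b [p0 [nQs Pp0 e]]]] [s' [b' [p0' [nQs' Pp0' e']]]].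
    exists (s * s'), (s' * b + s * b'), (s' * p0 + s * p0'); split.
    + exact: primeM.
    + by apply: idealD => //; exact: idealM.
    + have -> : s * s' * (a + a') = s' * (s * a) + s * (s' * a') by ring.
      by rewrite e e'; ring.
  - move=> c a [s [b [p0 [nQs Pp0 e]]]]; exists s, (c * b), (c * p0); split=> //.
      exact: idealM.
    by rewrite mulrCA e; ring.
have Id n : I n.+1 `<=` I n.
  move=> a [s [b [p0 [nQs Pp0 e]]]]; exists s, (b * y), p0; split=> //.
  by rewrite e exprS mulrA.
have P0I n : P0 `<=` I n.
  move=> a P0a; exists 1, 0, a; split=> //; first exact: prime1.
  by rewrite mul1r mul0r add0r.
have satI n s a : ~ Q s -> I n (s * a) -> I n a.
  move=> nQs [t [b [p0 [nQt Pp0 e]]]]; exists (t * s), b, p0.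
  by split=> //; [exact: primeM|rewrite -mulrA].
pose I' n := submod_add (I n : set R^o) (line (x : R^o)).
have [|||n nI] := @dcc_minimal_prime J P I' noeth idJ pP JP Pmin.
- by move=> n; apply: submodule_add; [exact: idI|exact: submodule_line].
- by move=> n _ [a [b [Ia xb ->]]]; exists a, b; split=> //; exact: Id.
- move=> n; apply: (@submod_add_min R R^o).
  + apply: submodule_add; [exact: idI|exact: submodule_line].
  + apply: subset_trans (P0I n) _; apply: (@submod_addl R R^o).
    exact: submodule_line.
  + apply: (@submod_addr R R^o); exact: idI.
have [s sI] := noeth _ (idI n).
have sI' v : v \in s -> I n v.
  by move=> vs; rewrite sI; apply: (@sub_span R R^o).
(* From [w * v = a + c * x] with [x] outside [Q], saturation puts [c] in [I n]. So [I n] is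
   contained, locally at [P], in [I n.+1] plus [P] times [I n], and Nakayama applies. *)
have [|v vs|w nPw Iw] := @nakayama R R^o P (I n.+1) s pP; first exact: idI.
  have [||w nPw /add_lineP[a [c [Ia wE]]]] := nI n.+1 _ v; first exact: leqnSn.
    by apply: (@submod_addl R R^o); [exact: submodule_line|exact: sI'].
  exists w => //; exists a, (c * x : R^o); split=> //.
  rewrite mulrC; apply: (lincombZ idP Px); rewrite lincombT_span -sI.
  apply: (satI n x) => //.
  have -> : x * c = w * v - a.
    by rewrite wE; ring.
  apply: idealB => //; last exact: Id.
  by apply: idealM => //; exact: sI'.
have nQw : ~ Q w by move=> /sQP.
have IIn a : I n a -> I n.+1 a.
  move=> Ia; apply: (satI _ w) => //; move: Ia; rewrite {1}sI.
  have sY : ideal [set z | I n.+1 (w * z)].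
    by exact: (@submodule_scale_preimage R R^o _ w (idI n.+1)).
  by apply: (@span_min R R^o _ _ sY) => z zs; exact: Iw.
(* Membership of [y ^+ n] in [I n.+1] puts [y ^+ n * (t - b * y)] in [P0]; as [y] is not in [P0],
   [t] would lie in [Q]. *)
have /IIn[t [b [p0 [nQt Pp0 e]]]] : I n (y ^+ n).
  exists 1, 1, 0; split; [exact: prime1|exact: ideal0|by rewrite addr0].
have Pyt : P0 (y ^+ n * (t - b * y)).
  have -> : y ^+ n * (t - b * y) = p0.
    by rewrite mulrBr mulrC e exprS; ring.
  by [].
have [_ _ P0M] := pP0; case: (P0M _ _ Pyt) => [/(primeX pP0)//|P0t].
by apply: nQt; rewrite -(subrK (b * y) t); apply: idealD;
  [|exact: sP0Q|exact: idealM].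
Qed.

Fixpoint prime_chain (n : nat) P P' : Prop :=
  if n is n'.+1 then exists Q, [/\ prime_ideal Q, P `<` Q & prime_chain n' Q P']
  else P = P'.

(** The principal ideal theorem pushes [x] down the chain one link at a time, until the prime next
    to [P] contains it. *)
Lemma prime_chain_through n P P' x : noetherian R -> prime_ideal P ->
  prime_chain n.+1 P P' -> P' x ->
  exists Q, [/\ prime_ideal Q, P `<` Q, Q x & prime_chain n Q P'].
Proof.
move=> noeth; elim: n P => [|n IHn] P pP [Q [pQ PQ chQ]] P'x.
  by exists Q; split=> //; rewrite chQ.
have [Q2 [pQ2 QQ2 Q2x chQ2]] := IHn Q pQ chQ P'x.
have [Q' [pQ' PQ' Q'x Q'Q2]] := principal_ideal_theorem noeth pP pQ pQ2 PQ QQ2 Q2x.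
have [Px|nPx] := pselect (P x).
  by exists Q; split=> //; case: PQ => + _; exact.
exists Q'; split=> //; last by exists Q2.
by split=> // Q'P; apply: nPx; exact: Q'P.
Qed.

(** Each element of [xs] costs one link. *)
Lemma prime_chain_seq n P P' (xs : seq R) : noetherian R -> prime_ideal P ->
  prime_chain (size xs + n) P P' -> (forall x, x \in xs -> P' x) ->
  exists Q, [/\ prime_ideal Q, P `<=` Q, forall x, x \in xs -> Q x &
    prime_chain n Q P'].
Proof.
move=> noeth; elim: xs P => [|x xs IHxs] P pP ch P'xs; first by exists P; split.
have [|Q [pQ [PQ _] Qx chQ]] := prime_chain_through noeth pP ch (x := x).
  by apply: P'xs; rewrite mem_head.
have [y yxs|Q' [pQ' QQ' Q'xs chQ']] := IHxs Q pQ chQ.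
  by apply: P'xs; rewrite inE yxs orbT.
exists Q'; split=> //; first exact: subset_trans QQ'.
by move=> y; rewrite inE => /orP[/eqP->|/Q'xs//]; exact: QQ'.
Qed.

Lemma prime_chain_extend n P P' m : P' `<=` m ->
  prime_ideal m -> prime_chain n.+1 P P' -> prime_chain n.+1 P m.
Proof.
move=> P'm pm; elim: n P => [|n IHn] P [Q [pQ PQ chQ]].
  exists m; split=> //; have [sub nsub] := PQ; rewrite -chQ in P'm.
  by split; [exact: subset_trans P'm|move=> mP; apply: nsub; exact: subset_trans mP].
by exists Q; split=> //; exact: IHn.
Qed.

(** The bound is the number of generators of [m]: a longer chain would leave one strict link above a
    prime already containing all of them. *)
Lemma local_chain_bound (m : set R) : noetherian R -> is_local m ->
  exists d, forall J n, chain_lengths J n -> (n <= d)%N.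
Proof.
move=> noeth lm; have pm := local_prime lm.
have [xs mE] := noeth m (prime_ideal_ideal pm).
have xsm x : x \in xs -> m x by move=> xxs; rewrite mE; exact: (@sub_span R R^o).
exists (size xs) => J n [p pP pS]; rewrite leqNgt; apply/negP => lt_n.
have chain k i : (i + k <= n)%N -> prime_chain k (p i) (p (i + k)%N).
  elim: k i => [|k IHk] i ik; first by rewrite addn0.
  exists (p i.+1); rewrite -addSnnS in ik *.
  have i1n : (i.+1 <= n)%N by apply: leq_trans ik; exact: leq_addr.
  by split; [case: (pP i.+1 i1n)|exact: pS|exact: IHk].
have [pp0 _] := pP 0%N isT.
have ch : prime_chain (size xs).+1 (p 0%N) m.
  apply: (@prime_chain_extend _ _ (p (0 + (size xs).+1)%N)) => //; last exact: chain.
  have [pp _] := pP _ lt_n.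
  by apply: local_max => //; [exact: prime_ideal_ideal|exact: prime1].
rewrite -addn1 in ch.
have [Q [pQ _ Qxs [Q' [pQ' [QQ' nQ'Q] Q'm]]]] := prime_chain_seq noeth pp0 ch xsm.
apply: nQ'Q; rewrite Q'm mE; apply: (@span_min R R^o) => //.
exact: prime_ideal_ideal.
Qed.

End FiniteDimension.

Section DimensionDrop.
Variable R : comNzRingType.
Implicit Types (I p q : set R).

Lemma supremum_nat_max (A : set nat) M : A M -> (forall n, A n -> (n <= M)%N) ->
  supremum -oo%E [set (n%:Z)%:E%E | n in A] = (M%:Z)%:E%E.
Proof.
move=> AM leM; set B := image _ _.
have BM : B (M%:Z)%:E%E by exists M.
rewrite /supremum; case: eqVneq => [B0|_]; first by rewrite B0 in BM.
have supM : supremums B (M%:Z)%:E%E.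
  split=> [_ [n An <-]|y]; last exact.
  by rewrite lee_fin lez_nat; exact: leM.
have := @xgetPex _ -oo%E (supremums B) (ex_intro _ _ supM).
by move=> /is_subset1_supremums; apply.
Qed.

(** Lengths are bounded, so a longest chain above [q] exists; prepending [p] makes it longer. *)
Lemma krull_dim_proper (m : set R) p q : noetherian R -> is_local m ->
  prime_ideal p -> prime_ideal q -> p `<` q ->
  krull_dim (quot_ring p) <> krull_dim (quot_ring q).
Proof.
move=> noeth lm pp pq pq_lt.
have [idp idq] := (prime_ideal_ideal pp, prime_ideal_ideal pq).
have [d bound] := local_chain_bound noeth lm.
have max I : prime_ideal I -> exists2 n, chain_lengths I n &
    forall k, chain_lengths I k -> (k <= n)%N.
  move=> pI; have ex0 : exists n, `[< chain_lengths I n >].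
    by exists 0%N; apply/asboolP; exists (fun=> I) => // i _; split.
  have le_d n : `[< chain_lengths I n >] -> (n <= d)%N by move=> /asboolP/bound.
  case: (ex_maxnP ex0 le_d) => n /asboolP In nmax; exists n => // k Ik.
  by apply: nmax; apply/asboolP.
have [a pa amax] := max p pp; have [b qb bmax] := max q pq.
rewrite !krull_dim_quot_ring // (supremum_nat_max pa amax).
rewrite (supremum_nat_max qb bmax) => -[ab].
have [c cP cS] := qb.
suff /amax : chain_lengths p b.+1 by rewrite ab ltnn.
exists (fun i => if i is j.+1 then c j else p).
  case=> [|i] ib; first by split.
  have [pc qc] := cP i ib; split=> //; apply: subset_trans qc.
  by case: pq_lt.
case=> [_|i ib]; last exact: cS.
have [_ qc] := cP 0%N isT; have [sub nsub] := pq_lt; split.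
  exact: subset_trans qc.
by move=> cp; apply: nsub; exact: subset_trans cp.
Qed.

End DimensionDrop.

(** * Artinian modules with a prescribed attached prime *)

Section ResidueDomain.
Variables (R : comNzRingType) (P : set R) (pP : prime_ideal P).

(** The proof of primality is a parameter of the type so that the domain structure can be inferred
    from it. *)
Definition residue_domain of prime_ideal P : Type := quot_ring P.

Local Notation T := (residue_domain pP).

HB.instance Definition _ := GRing.ComPzRing.on T.

Let idP : ideal P := prime_ideal_ideal pP.
Let pi (x : R) : T := residue P x.

Fact residue_domain_nonzero : (1 : T) != 0.
Proof.
by apply/eqP => /(residue_eq0 idP 1); exact: prime1.
Qed.

HB.instance Definition _ :=
  GRing.PzSemiRing_isNonZero.Build T residue_domain_nonzero.

(** Required by the interface of integral domains; inverses are chosen classically, with the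
    identity as default on non-units. *)
Definition residue_domain_unit : {pred T} :=
  fun x => `[< exists y, y * x = 1 >].

Definition residue_domain_inv (x : T) : T :=
  if pselect (exists y, y * x = 1) is left e then projT1 (cid e) else x.

Fact residue_domain_mulVx :
  {in residue_domain_unit, left_inverse 1 residue_domain_inv *%R}.
Proof.
move=> x /asboolP ex; rewrite /residue_domain_inv; case: pselect => // e.
by case: cid.
Qed.

Fact residue_domain_unitPl (x y : T) : y * x = 1 -> residue_domain_unit x.
Proof. by move=> yx; apply/asboolP; exists y. Qed.

Fact residue_domain_invr_out :
  {in [predC residue_domain_unit], residue_domain_inv =1 id}.
Proof.
move=> x; rewrite inE /= => /asboolP ex.
by rewrite /residue_domain_inv; case: pselect.
Qed.

HB.instance Definition _ := GRing.ComNzRing_hasMulInverse.Build T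
  residue_domain_mulVx residue_domain_unitPl residue_domain_invr_out.

Fact residue_domain_integral : GRing.integral_domain_axiom T.
Proof.
move=> a b; have [x <-] := residue_surj a; have [y <-] := residue_surj b.
rewrite -[_ * _](residueM P x y) => /(residue_eq0 idP).
have [_ _ PM] := pP => /PM xy; apply/orP.
by case: xy => h; [left|right]; apply/eqP/(residue_eq0 idP).
Qed.

HB.instance Definition _ :=
  GRing.ComUnitRing_isIntegral.Build T residue_domain_integral.

Definition to_residue_field (x : R) : {fraction T} := FracField.tofrac (pi x).

Fact to_residue_field_zmod : zmod_morphism to_residue_field.
Proof. by move=> x y; rewrite /to_residue_field /pi residueB tofracB. Qed.

Fact to_residue_field_monoid : monoid_morphism to_residue_field.
Proof.
split=> [|x y]; first exact: tofrac1.
by rewrite /to_residue_field /pi residueM tofracM.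
Qed.

HB.instance Definition _ := GRing.isZmodMorphism.Build R {fraction T}
  to_residue_field to_residue_field_zmod.
HB.instance Definition _ := GRing.isMonoidMorphism.Build R {fraction T}
  to_residue_field to_residue_field_monoid.

Lemma to_residue_field_eq0 x : to_residue_field x = 0 <-> P x.
Proof.
split=> [/eqP|Px]; first by rewrite tofrac_eq0 => /eqP/(residue_eq0 idP).
by apply/eqP; rewrite tofrac_eq0; apply/eqP/(residue_eq0 idP).
Qed.

End ResidueDomain.

(* With [K] the fraction field of [R / P] and [N] a submodule of [K] maximal
   among those avoiding [1], the class of [1] spans an essential simple socle
   of [K / N]; this makes the divisible module [K / N] Artinian. *)
Lemma artinian_secondary_module (R : comNzRingType) (m P : set R) :
  noetherian R -> is_local m -> prime_ideal P ->
  exists D : lmodType R, artinian D /\ coprimary P [set (0 : D)].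
Proof.
move=> noeth lm pP; have pm := local_prime lm; have idm := prime_ideal_ideal pm.
pose psi : {rmorphism R -> {fraction (residue_domain pP)}} := to_residue_field pP.
have psi0 x : psi x = 0 <-> P x by exact: to_residue_field_eq0.
pose V : lmodType R := restr psi ({fraction (residue_domain pP)})^o.
pose e : V := (1 : {fraction (residue_domain pP)}).
have e0 : e <> 0 by apply/eqP; exact: oner_neq0.
have divV r (v : V) : ~ P r -> exists w, v = r *: w.
  move=> nPr; have r0 : psi r != 0 by apply/eqP => /psi0.
  by exists ((psi r)^-1 * v); rewrite -[RHS]/(psi r * _) mulVKf.
have PV r (v : V) : P r -> r *: v = 0.
  by move=> /psi0 r0; rewrite -[LHS]/(psi r * v) r0 mul0r.
have [|N [sN _ Ne Nmax]] := @max_avoiding R V [set 0] [set e] (@submodule_set0 _ _).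
  by move=> _ -> /esym.
pose D : lmodType R := quot_mod N.
pose pi : V -> D := quot_pi N.
have pi_eq0 v : pi v = 0 <-> N v.
  rewrite -[N v](_ : Defs.span N (v - 0) = _); last by rewrite span_id ?subr0.
  by rewrite -quot_piP raddf0.
have piZ r v : pi (r *: v) = r *: pi v by exact: quot_pi_scalable.
have pi_surj d : exists v, pi v = d by exists (quot_repr d); exact: quot_reprK.
set u : D := pi e.
have u0 : u <> 0 by move=> /pi_eq0 Nu; exact: (Ne e).
(* For [v] outside [N], maximality makes [N + R v] contain [1]. *)
have ess d : d <> 0 -> exists c, u = c *: d.
  have [v <-] := pi_surj d => v0; apply: contrapT => h.
  apply/v0/pi_eq0; apply: (Nmax (submod_add N (line v))).
  - by apply: submodule_add => //; exact: submodule_line.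
  - by apply: submod_addl; exact: submodule_line.
  - move=> _ [a [_ [Na [c _ <-] ->]]] /= ae; apply: h; exists c.
    rewrite /u -ae -piZ /pi raddfD -[X in X + _]/(pi a).
    by rewrite (proj2 (pi_eq0 a) Na) add0r.
  - by apply: submod_addr => //; exact: line_mem.
have unit_sub c : m c -> exists y, y * (1 - c) = 1.
  move=> mc; apply: (local_unit lm) => m1; apply: (prime1 pm).
  by rewrite -(subrK c 1); exact: idealD.
have mu r : m r -> r *: u = 0.
  move=> mr; apply: contrapT => /ess[c ue].
  have [|y y1] := unit_sub (c * r); first exact: idealM.
  apply: u0; rewrite -[u]scale1r -y1 -scalerA scalerBl scale1r -scalerA -ue.
  by rewrite subrr scaler0.
(* The annihilators of [r ^+ k *: d] stabilise at [k]. If [c] sends [r ^+ k *: d] to [u], it kills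
   [r ^+ k.+1 *: d] because [r] kills [u], hence also [r ^+ k *: d], forcing [u = 0]. *)
have tors r : m r -> forall d : D, exists k, r ^+ k *: d = 0.
  move=> mr d; pose F := [set I | exists k : nat, I = [set a | a *: (r ^+ k *: d) = 0]].
  have [||_ [k ->] kmax] := @noetherian_max _ F noeth.
  - by exists [set a | a *: (r ^+ 0 *: d) = 0], 0%N.
  - move=> _ [k ->]; apply: ideal_intro => [|a b|a b] /=.
    + exact: scale0r.
    + by rewrite scalerDl => -> ->; rewrite addr0.
    + by rewrite -scalerA => ->; rewrite scaler0.
  exists k; apply: contrapT => /ess[c uE]; apply: u0; rewrite uE.
  apply: (kmax [set a | a *: (r ^+ k.+1 *: d) = 0]); first by exists k.+1.
    by move=> a /= ak; rewrite exprS -scalerA scalerA mulrC -scalerA ak scaler0.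
  by rewrite /= exprS -scalerA scalerA mulrC -scalerA -uE mu.
exists D; split.
  have [xs mE] := noeth m idm.
  have xsm x : x \in xs -> m x by move=> xxs; rewrite mE; exact: (@sub_span R R^o).
  apply/artinian_dcc; apply: (@dcc_torsion_seq _ _ _ xs).
  - exact: submodule_setT.
  - by move=> x /xsm mx v _; exact: tors.
  (* A nonzero [v] killed by [m] has a multiple [c *: v = u]; [c] is then a unit, so the socle is
     the line of [u]. *)
  apply: dcc_sub (dcc_line_simple lm mu) => v [_ xsv].
  have mv r : m r -> r *: v = 0.
    have idv : ideal [set r | r *: v = 0].
      apply: ideal_intro => [|a b|a b] /=.
      - exact: scale0r.
      - by rewrite scalerDl => -> ->; rewrite addr0.
      - by rewrite -scalerA => ->; rewrite scaler0.
    by rewrite {1}mE; apply: (@span_min R R^o _ _ idv).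
  have [->|/ess[c uE]] := pselect (v = 0).
    exact: submodule0 (submodule_line _).
  have nmc : ~ m c by move=> /mv c0; apply: u0; rewrite uE.
  have [y yc] := local_unit lm nmc; exists y => //.
  by rewrite uE scalerA yc scale1r.
split=> //.
- exact: submodule_set0.
- by move=> DT; apply: u0; rewrite -[u = 0]/([set (0 : D)] u) DT.
- move=> r nPr d; have [v <-] := pi_surj d; have [w ->] := divV r v nPr.
  by exists (pi w); rewrite /= piZ subrr.
- move=> r Pr; exists 1%N => d; have [v <-] := pi_surj d.
  by rewrite expr1 /= -piZ PV // /pi raddf0.
Qed.

(** A secondary module is covered by itself alone, so it has one attached prime. *)
Lemma coprimary_zero_uniq (R : comNzRingType) (V : lmodType R) (p q : set R)
  (K : set V) : coprimary p [set (0 : V)] -> coprimary q K -> q = p.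
Proof.
move=> [pp _ _ div nil] cK.
suff [] : exists _ : 'I_1, q = p by [].
apply: (@coprimary_cover R V 1 (fun=> p) (fun=> setT) q K _ _ _ _ cK) => //.
- move=> _ r npr x _; have [y /= xy] := div r npr x; exists y => //.
  by rewrite -(subrK (r *: y) x) xy add0r.
- by move=> _ r /nil[k rk]; exists k => x _; exact: rk.
- by move=> K' _ /(_ ord0) KT; apply/seteqP; split.
Qed.

Theorem theorem1p1 (R S : comNzRingType) (m : set R) (n : set S)
    (phi : {rmorphism R -> S}) :
  noetherian R -> is_local m -> noetherian S -> is_local n ->
  module_finite_extension phi ->
  [/\ (* (a) *)
      forall B : lmodType S,
        (artinian B <-> artinian (restr phi B)) /\
        (artinian B ->
           mdim B = mdim (restr phi B) /\
           Att B `<=` \bigcup_(p in Att (restr phi B))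
                        Assh (quot_mod (ideal_ext phi p : set S^o))),
      (* (b) *)
      forall A : lmodType R, artinian A ->
        [/\ artinian (base_change phi A),
            mdim (base_change phi A) = mdim A &
            Att (base_change phi A) `<=`
              \bigcup_(p in Att A)
                Assh (quot_mod (ideal_ext phi p : set S^o))] &
      (* (c) *)
      (forall B : lmodType S, artinian B ->
         Att B = \bigcup_(p in Att (restr phi B))
                   Assh (quot_mod (ideal_ext phi p : set S^o))) <->
      set_bij (Spec S) (Spec R) (fun P => contraction phi P)].
Proof.
move=> noethR locR noethS locS [phi_inj finS].
have art_restr (B : lmodType S) : artinian B -> artinian (restr phi B).
  exact: restr_artinian finS _ _ locR locS _.
have Att_prime (B : lmodType S) P : Att B P -> prime_ideal P.
  by move=> /Att_coprimary[K []].
have Att_sub (B : lmodType S) : artinian B ->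
    Att B `<=` \bigcup_(p in Att (restr phi B))
                 Assh (quot_mod (ideal_ext phi p : set S^o)).
  move=> art P AP; exists (contraction phi P).
    by apply: Att_restr AP; exact: art_restr.
  by apply: Assh_over => //; exact: Att_prime AP.
split.
- move=> B; split; first by split; [exact: art_restr|exact: restr_artinianW].
  by move=> art; split; [rewrite (mdim_restr finS)|exact: Att_sub].
- move=> A art; split; first exact: base_change_artinian.
    exact: mdim_base_change.
  move=> P AP; exists (contraction phi P); first exact: Att_base_change AP.
  by apply: Assh_over => //; exact: Att_prime AP.
split=> [AttE|[_ inj _] B art].
  split.
  - by move=> P; exact: prime_contraction.
  - move=> P P' /set_mem pP /set_mem pP' E.
    have [D [artD cD]] := artinian_secondary_module noethS locS pP.
    have : Att D P'.
      rewrite (AttE _ artD); exists (contraction phi P).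
        by apply: Att_restr (art_restr _ artD) _; apply/AttP => //; exists [set 0].
      by rewrite [contraction _ _]E; exact: Assh_over.
    by move=> /Att_coprimary[K /(coprimary_zero_uniq cD)].
  - by move=> p pp; have [P pP <-] := lying_over finS phi_inj pp; exists P.
apply/seteqP; split; first exact: Att_sub.
move=> P [p Ap]; have [k [q [N NB]]] := artinian_min_secondary_repr art.
have [sN NT _ _] := NB; have subN i := secondary_submodule (sN i).
(* The components of a representation over [S] also cover [B] over [R], with contracted primes;
   hence [p] is the contraction of an attached prime of [B]. *)
have [i pE] : exists i, p = contraction phi (q i).
  have [K cK] := Att_coprimary Ap.
  apply: (@coprimary_cover R (restr phi B) k (fun i => contraction phi (q i)) N
            _ _ _ _ _ _ cK).
  - by move=> i; apply: prime_contraction; case: (sN i).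
  - by move=> i r nqr x; exact: secondary_divisible (sN i) nqr.
  - move=> i r qr; have [_ _ _ nil] := sN i; have [l rl] := nil _ qr.
    by exists l => x /rl; rewrite -rmorphXn.
  - move=> K' sK' NK'; apply/seteqP; split=> // x _.
    have : [set: B] x by []; rewrite -NT => -[f fN ->].
    by apply: (@submodule_sum R (restr phi B)) => // j _; apply: (NK' j); exact: fN.
have pq : prime_ideal (q i) by case: (sN i).
have idE : ideal (ideal_ext phi p) by exact: ideal_ideal_ext.
(* Being contracted from [q i], [p] is recovered from its extension, which gives [S / pS] the
   dimension of [R / p]. *)
have pE' : contraction phi (ideal_ext phi p) = p.
  apply/seteqP; split=> r; last exact: ideal_ext_mem.
  rewrite {2}pE; apply: (ideal_ext_sub (prime_ideal_ideal pq)).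
  by rewrite pE.
move=> /(AsshE _ idE)[pP [x Px] dimE].
have EP : ideal_ext phi p `<=` P by move=> s Es; rewrite Px; exact: (ideal_mulr x idE Es).
have pP' : p `<=` contraction phi P by rewrite -{1}pE' => r /EP.
have E : contraction phi P = contraction phi (q i).
  rewrite -pE; apply: contrapT => nE.
  have pp : prime_ideal p by rewrite pE; exact: prime_contraction.
  apply: (krull_dim_proper noethR locR pp (prime_contraction phi pP)).
    by split=> // Pp; apply: nE; apply/seteqP.
  rewrite (krull_dim_contraction finS (prime_ideal_ideal pP)) dimE.
  by rewrite -(krull_dim_contraction finS idE) pE'.
have -> : P = q i by apply: inj => //; exact: mem_set.
by exists k, q, N; split=> //; exists i.
Qed.
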